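(* Let $n\ge 4$, let $K$ be a field with $\operatorname{char}(K)=0$, let $R=K[x_1,\ldots,x_n]$, and let $I^{\rm Sp}_{(n-2,2)}=(f_T\mid T\in \operatorname{Tab}(n-2,2))\subset R$ be the Specht ideal of shape $(n-2,2)$. Then the sequence $$\mathcal F_\bullet^{(n-2,2)}:\ 0\to F_{n-2}\xrightarrow{\partial_{n-2}}F_{n-3}\xrightarrow{\partial_{n-3}}\cdots\xrightarrow{\partial_2}F_1\xrightarrow{\partial_1}F_0\to 0$$ defined in the context is a minimal graded free resolution of $R/I^{\rm Sp}_{(n-2,2)}$.
   Context: Tableaux. For a partition $\lambda$ of $n$ (exponential notation: $1^k$ means $k$ parts equal to $1$), a Young tableau of shape $\lambda$ is a bijective filling of the Young diagram of $\lambda$ (rows from top to bottom of lengths $\lambda_1\ge\lambda_2\ge\cdots$, left-justified) by $[n]=\{1,\ldots,n\}$. $\operatorname{Tab}(\lambda)$ is the set of all of them. Specht polynomials. If the $j$-th column of $T\in\operatorname{Tab}(\lambda)$ consists of $j_1,\ldots,j_m$ from top to bottom, put $f_T(j)=\prod_{1\le s<t\le m}(x_{j_s}-x_{j_t})$, and $f_T=\prod_{j=1}^{\lambda_1}f_T(j)\in R$. Specht modules. Two tableaux of shape $\lambda$ are row equivalent if corresponding rows contain the same elements; the tabloid $\{T\}$ is the row equivalence class of $T$. $C(T)\subset\mathfrak S_n$ is the column stabilizer of $T$ (product of the symmetric groups on the columns of $T$), and the polytabloid of $T$ is $e(T)=\sum_{\pi\in C(T)}\operatorname{sgn}(\pi)\,\pi\{T\}$,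 an element of the $K$-vector space with basis the tabloids of shape $\lambda$. The Specht module is $V_\lambda=\sum_{T\in\operatorname{Tab}(\lambda)}K e(T)$. The free modules. $R$ has the standard grading and $R(-a)$ is $R$ with generator in degree $a$. $F_0=R$; $F_i=V_{(n-1-i,\,2,\,1^{i-1})}\otimes_K R(-1-i)$ for $1\le i\le n-3$; $F_{n-2}=V_{(1^n)}\otimes_K R(-n)$. The maps ($R$-linear, determined by their values on the elements $e(T)\otimes 1$; these values are compatible with the linear relations among the $e(T)$): (i) $\partial_1(e(T)\otimes 1)=f_T$ for $T\in\operatorname{Tab}(n-2,2)$. (ii) For $2\le i\le n-3$, let $T\in\operatorname{Tab}(n-1-i,2,1^{i-1})$ have first column $a_1,a_2,\ldots,a_{i+1}$ (top to bottom), second column $b_1,b_2$ (top to bottom), and remaining first-row entries $c_1,\ldots,c_{n-3-i}$ (left to right). For $1\le j\le i+1$ let $T_j\in\operatorname{Tab}(n-i,2,1^{i-2})$ be the tableau with first column $a_1,\ldots,a_{j-1},a_{j+1},\ldots,a_{i+1}$, second column $b_1,b_2$, and remaining first-row entries $c_1,\ldots,c_{n-3-i},a_j$. Then $$\partial_i(e(T)\otimes 1)=\sum_{j=1}^{i+1}(-1)^{j-1}e(T_j)\otimes x_{a_j}\in F_{i-1}.$$ (iii) Let $T\in\operatorname{Tab}(1^n)$ be the single column $1,2,\ldots,n$ (top to bottom). For $1\le j<k\le n$ let $T_{j,k}\in\operatorname{Tab}(2,2,1^{n-4})$ have first column the elements of $[n]\setminus\{j,k\}$ in increasing order from top to bottom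 and second column $j,k$ (top to bottom). Then $$\partial_{n-2}(e(T)\otimes 1)=\sum_{1\le j<k\le n}(-1)^{j+k-1}e(T_{j,k})\otimes x_jx_k\in F_{n-3}.$$ *)

(* Defs.v *)
From HB Require Import structures.
From mathcomp Require Import all_boot all_order all_algebra all_fingroup.
From mathcomp Require Import mpoly.

Set Implicit Arguments.
Unset Strict Implicit.
Unset Printing Implicit Defensive.

Import GRing.Theory.
Local Open Scope ring_scope.

(* The entry k in {1, ..., n} of a tableau and the variable x_k are indexed   *)
(* by the element of 'I_n with value k - 1.                                   *)

Section Tableaux.
Variable n : nat.

(* A tableau is the list of its rows, from top to bottom. For lam a partition *)
(* of n, [Tab lam] lists the bijective fillings of lam, each one encoded by   *)
(* its row reading word; see [mem_Tab].                                       *)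
Definition Tab (lam : seq nat) : seq (seq (seq 'I_n)) :=
  [seq reshape lam w | w <- permutations (enum 'I_n)].

Lemma mem_Tab (lam : seq nat) (T : seq (seq 'I_n)) : sumn lam = n ->
  (T \in Tab lam) = (shape T == lam) && perm_eq (flatten T) (enum 'I_n).
Proof.
move=> lam_n; apply/mapP/andP => [[w]|[/eqP <- ?]].
  rewrite mem_permutations => w_enum ->.
  have size_w : size w = sumn lam.
    by rewrite (perm_size w_enum) size_enum_ord lam_n.
  by rewrite reshapeKl ?size_w // eqxx reshapeKr ?size_w.
by exists (flatten T); rewrite ?mem_permutations // flattenK.
Qed.

(* Turns a list of rows into the list of columns, and conversely. *)
Definition transpose (T : seq (seq 'I_n)) : seq (seq 'I_n) :=
  [seq pmap (fun r => onth r j) T | j <- iota 0 (size (head [::] T))].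

Definition columns (T : seq (seq 'I_n)) := transpose T.
Definition tableau_of_columns (cs : seq (seq 'I_n)) := transpose cs.

(* First column a, second column b, and c the rest of the first row. *)
Definition tableau2 (a b c : seq 'I_n) : seq (seq 'I_n) :=
  tableau_of_columns [:: a, b & [seq [:: x] | x <- c]].

Definition act_tableau (s : 'S_n) (T : seq (seq 'I_n)) : seq (seq 'I_n) :=
  [seq [seq s x | x <- r] | r <- T].

(* A tabloid gives, for each row index, the set of the entries of the row     *)
(* (empty past the last row): T and T' are row equivalent if and only if      *)
(* [tabloid_of T = tabloid_of T'].                                            *)
Definition tabloid := {ffun 'I_n -> {set 'I_n}}.

Definition tabloid_of (T : seq (seq 'I_n)) : tabloid :=
  [ffun i : 'I_n => [set x in nth [::] T i]].

Definition column_stab (T : seq (seq 'I_n)) : {set 'S_n} :=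
  [set s : 'S_n | all (fun c => all (fun x => s x \in c) c) (columns T)].

End Tableaux.

Section SpechtTheory.
Variables (K : fieldType) (n : nat).
Notation R := {mpoly K[n]}.

Definition specht_col (c : seq 'I_n) : R :=
  \prod_(s < size c) \prod_(t < size c | (s < t)%N)
    ('X_(tnth (in_tuple c) s) - 'X_(tnth (in_tuple c) t)).

Definition specht_poly (T : seq (seq 'I_n)) : R :=
  \prod_(c <- columns T) specht_col c.

Definition specht_ideal (lam : seq nat) (p : R) : Prop :=
  exists g : seq (seq 'I_n) -> R, p = \sum_(T <- Tab n lam) g T * specht_poly T.

(* This space has the tabloids of all shapes as a basis; the vectors          *)
(* [polytabloid T] with T of shape lam lie in the span of those of shape lam. *)
Definition tabloid_space := {ffun tabloid n -> K^o}.

Definition tabloid_vec (t : tabloid n) : tabloid_space :=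
  [ffun u => (u == t)%:R].

Definition polytabloid (T : seq (seq 'I_n)) : tabloid_space :=
  \sum_(s in column_stab T)
    (-1) ^+ odd_perm s *: tabloid_vec (tabloid_of (act_tableau s T)).

Definition specht_module (lam : seq nat) : {vspace tabloid_space} :=
  <<[seq polytabloid T | T <- Tab n lam]>>%VS.

(* U (x)_K R, written in the coordinates given by a K-basis of U. The pure    *)
(* tensor [tens U v r] is v (x) r, for v in U; see [tensP] for the universal  *)
(* property.                                                                  *)
Definition tensor (U : {vspace tabloid_space}) := 'rV[R]_(\dim U).

Definition tens (U : {vspace tabloid_space}) (v : tabloid_space) (r : R) :
    tensor U :=
  \row_j (coord (vbasis U) j v *: r).

Lemma tensP (U : {vspace tabloid_space}) (W : lmodType R)
    (phi : tabloid_space -> W) :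
  (forall c, {in U &, forall u v, phi (c *: u + v) = c%:MP *: phi u + phi v}) ->
  exists2 f : {linear tensor U -> W},
    forall v r, v \in U -> f (tens U v r) = r *: phi v &
    forall g : {linear tensor U -> W},
      (forall v, v \in U -> g (tens U v 1) = phi v) -> g =1 f.
Proof.
move=> phi_lin.
have phi0 : phi 0 = 0.
  have := phi_lin (-1) 0 0 (mem0v _) (mem0v _).
  by rewrite scaler0 addr0 mpolyCN scaleN1r addNr.
have phi_sum (c : 'I_(\dim U) -> K) :
    phi (\sum_j c j *: (vbasis U)`_j) = \sum_j (c j)%:MP *: phi (vbasis U)`_j.
  suff [] : \sum_j c j *: (vbasis U)`_j \in U /\
    phi (\sum_j c j *: (vbasis U)`_j) = \sum_j (c j)%:MP *: phi (vbasis U)`_j by [].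
  elim/big_rec2: _ => [|j y x _ [xU phix]]; first by rewrite mem0v.
  have bU : (vbasis U)`_j \in U by rewrite vbasis_mem // mem_nth ?size_tuple.
  by rewrite memvD ?memvZ // phi_lin // phix.
pose f (u : tensor U) : W := \sum_j u 0 j *: phi (vbasis U)`_j.
have f_lin : linear f.
  move=> a u v; rewrite /f scaler_sumr -big_split; apply: eq_bigr => j _ /=.
  by rewrite !mxE scalerDl scalerA.
pose fM := GRing.isLinear.Build _ _ _ _ f f_lin.
pose fL : {linear tensor U -> W} := HB.pack f fM.
exists fL => [v r vU|g g_tens u].
  rewrite /= /f [in RHS](coord_vbasis vU) phi_sum scaler_sumr.
  by apply: eq_bigr => j _; rewrite mxE -mul_mpolyC scalerA mulrC.
rewrite [u in LHS]row_sum_delta linear_sum; apply: eq_bigr => j _.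
rewrite linearZ /=; congr (_ *: _).
have bU : (vbasis U)`_j \in U by rewrite vbasis_mem // mem_nth ?size_tuple.
rewrite -g_tens //; congr (g _); apply/rowP => k.
rewrite !mxE eqxx /= coord_free ?(basis_free (vbasisP U)) //.
by case: eqP => [->|/eqP]; rewrite ?eqxx ?scale1r // eq_sym => /negPf->; rewrite scale0r.
Qed.

(* [homogeneous d] is the set of the homogeneous elements of degree d, 0 included.  *)
(* No element but 0 has negative degree.                                      *)
Record gmod := Gmod {
  gmod_mod :> lmodType R;
  homogeneous : nat -> gmod_mod -> Prop }.

(* p is homogeneous of degree d in R(-a) *)
Definition shifted_homog (a d : nat) (p : R) : bool :=
  if (a <= d)%N then p \is (d - a).-homog else p == 0.

(* M is isomorphic, as a graded module, to a finite sum of modules R(-a). *)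
Definition graded_free (M : gmod) : Prop :=
  exists (r : nat) (b : 'I_r -> M) (a : 'I_r -> nat),
    (forall x : M, exists! c : {ffun 'I_r -> R}, x = \sum_i c i *: b i) /\
    (forall (d : nat) (c : {ffun 'I_r -> R}),
       homogeneous d (\sum_i c i *: b i) <->
       forall i, shifted_homog (a i) d (c i)).

Definition graded_map (M N : gmod) (f : M -> N) : Prop :=
  forall d x, homogeneous d x -> homogeneous d (f x).

(* y lies in (x_1, ..., x_n) M *)
Definition in_irrelevant (M : gmod) (y : M) : Prop :=
  exists z : 'I_n -> M, y = \sum_k 'X_k *: z k.

Definition gpoly : gmod := @Gmod R^o (fun d p => p \is d.-homog).

Definition gtensor (U : {vspace tabloid_space}) (a : nat) : gmod :=
  @Gmod (tensor U) (fun d u => forall j, shifted_homog a d (u 0 j)).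

(* ... -> F 2 -> F 1 -> F 0 -> R/I -> 0, where d i maps F (i + 1) to F i and  *)
(* the augmentation is eps followed by the projection of R onto R/I.          *)
Record minimal_graded_free_resolution (I : R -> Prop) (F : nat -> gmod)
    (d : forall i, {linear F i.+1 -> F i}) (eps : {linear F 0%N -> gpoly}) :
    Prop := MinimalGradedFreeResolution {
  mgfr_free : forall i, graded_free (F i);
  mgfr_graded : forall i, graded_map (d i);
  mgfr_graded_aug : graded_map eps;
  mgfr_exact : forall i (x : F i.+1),
    d i x = 0 <-> exists y : F i.+2, x = d i.+1 y;
  mgfr_exact_aug : forall x : F 0%N, I (eps x) <-> exists y, x = d 0%N y;
  mgfr_surj_aug : forall p : R, exists x : F 0%N, I (p - eps x);
  mgfr_minimal : forall i (x : F i.+1), in_irrelevant (d i x) }.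

(* F_i is the tensor product of [resolution_specht i] with                    *)
(* R(- [resolution_shift i]), for i > 0; it is zero for i > n - 2.            *)
Definition resolution_specht (i : nat) : {vspace tabloid_space} :=
  if (i <= n - 3)%N then specht_module [:: n - 1 - i, 2 & nseq (i - 1) 1]%N
  else if i == (n - 2)%N then specht_module (nseq n 1%N)
  else 0%VS.

Definition resolution_shift (i : nat) : nat :=
  if (i <= n - 3)%N then i.+1 else n.

Definition resolution_module (i : nat) : gmod :=
  if i is j.+1 then gtensor (resolution_specht j.+1) (resolution_shift j.+1)
  else gpoly.

(* e(T) (x) r in F_i *)
Definition etens (i : nat) (T : seq (seq 'I_n)) (r : R) :=
  tens (resolution_specht i) (polytabloid T) r.

(* The differential of index i from F_i to F_(i - 1) is d (i - 1). Indices    *)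
(* j, k starting from 0, (-1)^(j - 1) and (-1)^(j + k - 1) become             *)
(* (-1)^j and (-1)^(j + k + 1).                                               *)
Record resolution_differential
    (d : forall i, {linear resolution_module i.+1 -> resolution_module i}) :
    Prop := ResolutionDifferential {
  differential_first : forall T, T \in Tab n [:: n - 2; 2]%N ->
    d 0%N (etens 1 T 1) = specht_poly T;
  differential_middle : forall i, (i.+2 <= n - 3)%N ->
    forall T a b c,
      T \in Tab n [:: n - 1 - i.+2, 2 & nseq i.+1 1]%N ->
      columns T = [:: a, b & [seq [:: x] | x <- c]] ->
    d i.+1 (etens i.+2 T 1) =
    \sum_(j < size a)
      let aj := tnth (in_tuple a) j in
      let Tj := tableau2 (take j a ++ drop j.+1 a) b (rcons c aj) in
      (-1) ^+ j *: etens i.+1 Tj 'X_aj;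
  differential_last : forall i, i.+2 = (n - 2)%N ->
    d i.+1 (etens i.+2 (tableau_of_columns [:: enum 'I_n]) 1) =
    \sum_(j < n) \sum_(k < n | (j < k)%N)
      let Tjk := tableau2 [seq x <- enum 'I_n | x \notin [:: j; k]]
                          [:: j; k] [::] in
      (-1) ^+ (j + k + 1) *: etens i.+1 Tjk ('X_j * 'X_k) }.

End SpechtTheory.

(* Main.v *)
(* Evaluating a vector of the Specht module of shape (n-2-h, 2, 1^h) at the    *)
(* tabloid with second row {p, q} and further rows l turns V (x) R into a      *)
(* module of functions z(p, q, l), symmetric in p, q, alternating in l and cut *)
(* out by linear equations ([specht_form]). Then e(T) becomes                  *)
(* B(p) A(q :: l) + B(q) A(p :: l), where A is the contraction with (1, .., 1) *)
(* of the wedge of the first column and B the difference of the indicators of  *)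
(* the two entries of the second column; the differential becomes contraction  *)
(* with (x_1, .., x_n), i.e. the Koszul differential.                          *)
(* Every such z is u_p(q :: l) + u_q(p :: l) for a family of alternating       *)
(* functions u_p killed by the contraction with (1, .., 1), not involving p,   *)
(* with sum zero. Here u_p lives in the Koszul complex on the differences of   *)
(* the x_a, a <> p (the p-th component of the variety of the Specht ideal),    *)
(* and the sum of the u_p in the Koszul complex on all the differences. Both   *)
(* are exact by the Euler homotopy, as char K = 0, and a diagram chase gives   *)
(* exactness. The sum map is onto except in the top degree n - 1, whose one    *)
(* missing generator accounts for the last module V_(1^n) (x) R(-n).           *)

(* Write $d$ for contraction with $(x_1,\ldots,x_n)$. The dictionary between the modules and the
   Specht forms rests on [polytabloid_eval], which computes the form of a polytabloid.
   [specht_form_tensor], [tensor_form_inj] and [tensor_form_surj] then identify $F_{h+1}$, for $h\le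
   n-4$, with the Specht forms of degree $h$. By [middle_form], [first_form] and [last_value_form]
   the maps become $d$, half of the evaluation $\sum_{p,q} x_px_qz_{pq}$, and multiplication of the
   single form [top_form]. Maps with the prescribed values exist because these descriptions do not
   mention the $e(T)$.

   Exactness is a chase. Let a cycle $z$ come from a lift $(u_p)$, that is,
   $z_{pq}=u_p(q\,\cdot)+u_q(p\,\cdot)$. The lift can be chosen with all $du_p=0$
   ([koszul_cycle_lift]). By [koszul_exact] with the letter $p$ deleted, $u_p=dw_p$. The sum $\sum_p
   w_p$ is a cycle, so it equals $ds$ by [koszul_exact] with nothing deleted ([lift_boundary]). If
   $s$ has degree at most $n-2$, then $s=\sum_p v_p$ with $v_p$ not involving $p$ ([split_sum]); the
   $w_p-dv_p$ are primitives of the $u_p$ with sum zero, hence a lift, and its form bounds $z$ up to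
   sign ([specht_form_exact]). If $s$ has degree $n-1$, it is a multiple $r$ of one element, and the
   same chase with an explicit correction gives $z=-r\cdot$[top_form] ([specht_form_exact_top]).
   Since [top_form] is nonzero over a domain, the last map is injective ([last_inj]).

   Gradedness and minimality are read off the values on generators, whose coefficients are
   homogeneous of degree 1 or 2. *)
From HB Require Import structures.
From Stdlib Require ClassicalEpsilon.
Require Import Defs.
From mathcomp Require Import all_boot all_order all_algebra all_fingroup.
From mathcomp Require Import mpoly ring zify.

Set Implicit Arguments.
Unset Strict Implicit.
Unset Printing Implicit Defensive.

Import GRing.Theory.
Local Open Scope ring_scope.

(** * Alternating functions on words *)

Section Alternating.
Variables (K : fieldType) (charK0 : [pchar K] =i pred0).
Variables (R : comAlgType K) (I : finType).
Implicit Types (f g : seq I -> R) (y : I -> R) (a b : I) (l s t : seq I).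

Lemma natK_neq0 k : k.+1%:R != 0 :> K.
Proof. by have /pcharf0P-> := charK0. Qed.

Lemma natKV (V : lmodType K) k (x z : V) :
  x *+ k.+1 = z -> x = k.+1%:R^-1 *: z.
Proof. by move=> <-; rewrite -scaler_nat scalerA mulVf ?scale1r ?natK_neq0. Qed.

Lemma mulrnI0 (V : lmodType K) k (x : V) : x *+ k.+1 = 0 -> x = 0.
Proof. by move/natKV; rewrite scaler0. Qed.

Lemma eqrN_eq0 (V : lmodType K) (x : V) : x = - x -> x = 0.
Proof. by move=> xN; apply: (@mulrnI0 _ 1); rewrite mulr2n {1}xN addNr. Qed.

(** An element of the exterior algebra is stored as its coefficients on all words, repeated letters
    included. Adjacent swaps generate all sign rules, and in characteristic zero they force the
    value 0 on a word with a repetition ([alternating_uniq]). *)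
Definition alternating f :=
  forall s a b t, f (s ++ [:: a, b & t]) = - f (s ++ [:: b, a & t]).

Definition off (P : pred I) f := forall l, has P l -> f l = 0.

Definition degree_eq k f := forall l, size l != k -> f l = 0.

(** Left exterior multiplication by the basis vector $e_a$, expanded along the first letter of the
    word. *)
Fixpoint wedge a f l : R :=
  if l is b :: l' then f l' *+ (a == b) - wedge a (fun m => f (b :: m)) l'
  else 0.

(* Contraction of [f] with the linear form of coefficients [y]; with [y = x]  *)
(* this is the Koszul differential.                                           *)
Definition contract y f l : R := \sum_a y a * f (a :: l).

Definition unit_form l : R := (l == [::])%:R.

Definition wedges (m : seq I) : seq I -> R := foldr wedge unit_form m.

Lemma alternating_cons a f : alternating f -> alternating (fun m => f (a :: m)).
Proof. by move=> f_alt s b c t; apply: (f_alt (a :: s)). Qed.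

Lemma alternating2 f a b l : alternating f -> f [:: a, b & l] = - f [:: b, a & l].
Proof. by move=> f_alt; apply: (f_alt [::]). Qed.

Lemma off_cons P a f : off P f -> off P (fun m => f (a :: m)).
Proof. by move=> offf l Pl; apply: offf; rewrite /= Pl orbT. Qed.

Lemma degree_cons k a f : degree_eq k.+1 f -> degree_eq k (fun m => f (a :: m)).
Proof. by move=> homf l sl; apply: homf; rewrite eqSS. Qed.

Lemma eq_wedge a f g l :
  (forall m, (size m).+1 = size l -> f m = g m) -> wedge a f l = wedge a g l.
Proof.
elim: l f g => //= b l IH f g fg; rewrite fg //; congr (_ - _).
by apply: IH => m sm; rewrite fg //= sm.
Qed.

Lemma wedge_sum a (J : Type) (r : seq J) (P : pred J) (c : J -> R)
    (F : J -> seq I -> R) l :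
  wedge a (fun m => \sum_(j <- r | P j) c j * F j m) l =
  \sum_(j <- r | P j) c j * wedge a (F j) l.
Proof.
elim: l F => [|b l IH] F /=; first by rewrite big1 // => j _; rewrite mulr0.
rewrite (IH (fun j m => F j (b :: m))) -sumrMnl -sumrB; apply: eq_bigr => j _.
by rewrite mulrBr mulrnAr.
Qed.

Lemma raddf_wedge (T : {additive R -> R}) a f l :
  wedge a (fun m => T (f m)) l = T (wedge a f l).
Proof.
elim: l f => [|b l IH] f /=; first by rewrite raddf0.
by rewrite (IH (fun m => f (b :: m))) raddfB raddfMn.
Qed.

Lemma wedgeN a f l : wedge a (fun m => - f m) l = - wedge a f l.
Proof. exact: (raddf_wedge (-%R : {additive R -> R})). Qed.

Lemma wedgeD a f g l : wedge a (fun m => f m + g m) l = wedge a f l + wedge a g l.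
Proof.
elim: l f g => [|b l IH] f g /=; first by rewrite addr0.
by rewrite IH mulrnDl opprD addrACA.
Qed.

Lemma wedgeM a c f l : wedge a (fun m => c * f m) l = c * wedge a f l.
Proof.
elim: l f => [|b l IH] f /=; first by rewrite mulr0.
by rewrite (IH (fun m => f (b :: m))) mulrBr mulrnAr.
Qed.

Lemma wedge0 a f l : (forall m, (size m).+1 = size l -> f m = 0) -> wedge a f l = 0.
Proof.
move/eq_wedge->; elim: l => //= b l IH.
by rewrite mul0rn sub0r IH oppr0.
Qed.

Lemma degree_wedge k a f : degree_eq k f -> degree_eq k.+1 (wedge a f).
Proof.
move=> homf l sl; apply: wedge0 => m sm.
by apply: homf; rewrite -eqSS sm.
Qed.

Lemma alternating_wedge a f : alternating f -> alternating (wedge a f).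
Proof.
move=> f_alt s; elim: s f f_alt => [|d s IH] f f_alt b c t /=.
  rewrite (_ : wedge a (fun m => f [:: c, b & m]) t =
               - wedge a (fun m => f [:: b, c & m]) t); last first.
    by rewrite -wedgeN; apply: eq_wedge => m _; rewrite alternating2.
  by rewrite !opprB opprK addrA [in RHS]addrC addrCA addrA; ring.
rewrite (IH (fun m => f (d :: m))); last exact: alternating_cons.
by rewrite f_alt opprD mulNrn.
Qed.

Lemma off_wedge (P : pred I) a f : ~~ P a -> off P f -> off P (wedge a f).
Proof.
move=> Pa offf l; elim: l f offf => //= b l IH f offf /orP[Pb|Pl].
  rewrite (_ : a == b = false) ?sub0r; last by apply: contraNF Pa => /eqP->.
  by rewrite wedge0 ?oppr0 // => m _; apply: offf; rewrite /= Pb.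
by rewrite offf // mul0rn sub0r IH ?oppr0 //; apply: off_cons.
Qed.

Lemma contract1 f l : contract (fun=> 1) f l = \sum_a f (a :: l).
Proof. by apply: eq_bigr => a _; rewrite mul1r. Qed.

Lemma eq_contract y f g l :
  (forall m, size m = (size l).+1 -> f m = g m) -> contract y f l = contract y g l.
Proof. by move=> fg; apply: eq_bigr => a _; rewrite fg. Qed.

Lemma contract_sum y (J : Type) (r : seq J) (P : pred J) (c : J -> R)
    (F : J -> seq I -> R) l :
  contract y (fun m => \sum_(j <- r | P j) c j * F j m) l =
  \sum_(j <- r | P j) c j * contract y (F j) l.
Proof.
rewrite /contract; under eq_bigr do rewrite mulr_sumr.
rewrite exchange_big; apply: eq_bigr => j _ /=; rewrite mulr_sumr.
by apply: eq_bigr => a _; rewrite mulrCA.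
Qed.

Lemma contractN y f l : contract y (fun m => - f m) l = - contract y f l.
Proof. by rewrite /contract -sumrN; apply: eq_bigr => a _; rewrite mulrN. Qed.

Lemma contractD y f g l :
  contract y (fun m => f m + g m) l = contract y f l + contract y g l.
Proof. by rewrite /contract -big_split; apply: eq_bigr => a _; rewrite mulrDr. Qed.

Lemma contractM y c f l : contract y (fun m => c * f m) l = c * contract y f l.
Proof. by rewrite /contract mulr_sumr; apply: eq_bigr => a _; rewrite mulrCA. Qed.

Lemma contractZ y (c : K) f l : contract y (fun m => c *: f m) l = c *: contract
  y f l.
Proof. by rewrite /contract scaler_sumr; apply: eq_bigr => a _;
  rewrite scalerAr. Qed.

Lemma contract0 y f l :
  (forall m, size m = (size l).+1 -> f m = 0) -> contract y f l = 0.
Proof. by move=> f0; rewrite /contract big1 // => a _; rewrite f0 ?mulr0. Qed.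

Lemma alternating_contract y f : alternating f -> alternating (contract y f).
Proof.
move=> f_alt s a b t; rewrite /contract -sumrN; apply: eq_bigr => c _.
by rewrite -mulrN; congr (_ * _); apply: (f_alt (c :: s)).
Qed.

Lemma off_contract (P : pred I) y f : off P f -> off P (contract y f).
Proof.
by move=> offf l Pl; rewrite /contract big1 // => a _;
  rewrite offf ?mulr0 //= Pl orbT.
Qed.

Lemma degree_contract k y f : degree_eq k.+1 f -> degree_eq k (contract y f).
Proof.
by move=> homf l sl; apply: contract0 => m sm; apply: homf; rewrite sm eqSS.
Qed.

Lemma contract_anticomm y z f l : alternating f ->
  contract y (contract z f) l = - contract z (contract y f) l.
Proof.
move=> f_alt; rewrite /contract.
under eq_bigr do rewrite mulr_sumr; rewrite exchange_big -sumrN.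
apply: eq_bigr => b _; rewrite mulr_sumr -sumrN; apply: eq_bigr => a _ /=.
by rewrite (alternating2 _ _ _ f_alt) !mulrN mulrCA.
Qed.

Lemma contract_contract y f l : alternating f -> contract y (contract y f) l = 0.
Proof. by move=> f_alt; apply: eqrN_eq0; apply: contract_anticomm. Qed.

(** Contraction is an antiderivation of the exterior algebra; all the homotopies below come from
    this formula. *)
Lemma contract_wedge y a f l :
  contract y (wedge a f) l = y a * f l - wedge a (contract y f) l.
Proof.
rewrite /contract /=; under eq_bigr do rewrite mulrBr; rewrite sumrB; congr (_ - _).
  rewrite (bigD1 a) //= eqxx mulr1n big1 ?addr0 // => b /negPf ba.
  by rewrite eq_sym ba mulr0.
by rewrite (wedge_sum a _ _ _ (fun b m => f (b :: m))).
Qed.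

(** The number operator: $\sum_a e_a\wedge\iota_a$ multiplies by the degree. *)
Lemma wedge_contract_cons f l : alternating f ->
  \sum_a wedge a (fun m => f (a :: m)) l = f l *+ size l.
Proof.
elim: l f => [|b l IH] f f_alt /=; first by rewrite big1.
rewrite sumrB (bigD1 b) //= eqxx big1 ?addr0 => [|a /negPf->] //.
rewrite (eq_bigr (fun a => - wedge a (fun m => f [:: b, a & m]) l)); last first.
  by move=> a _; rewrite -wedgeN; apply: eq_wedge => m _; rewrite alternating2.
rewrite sumrN opprK (IH (fun m => f (b :: m))) ?mulr1n -?mulrS //.
exact: alternating_cons.
Qed.

Lemma alternating_dup f s a t u : alternating f ->
  f (s ++ a :: t ++ a :: u) = 0.
Proof.
move=> f_alt; elim: t s => [|b t IH] s /=; first by apply: eqrN_eq0; apply: f_alt.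
by rewrite f_alt -cat_rcons IH oppr0.
Qed.

Lemma alternating_uniq f l : alternating f -> ~~ uniq l -> f l = 0.
Proof.
move=> f_alt; elim: l f f_alt => //= a l IH f f_alt.
rewrite negb_and negbK => /orP[|Nl];
  last by rewrite (IH (fun m => f (a :: m))) //; apply: alternating_cons.
by case/splitPr=> s t; apply: (@alternating_dup f [::]).
Qed.

Lemma alternating_mem f a l : alternating f -> a \in l -> f (a :: l) = 0.
Proof. by move=> f_alt al; apply: alternating_uniq => //=; rewrite al. Qed.

Lemma alternating_swap f s a b t u : alternating f ->
  f (s ++ a :: t ++ b :: u) = - f (s ++ b :: t ++ a :: u).
Proof.
move=> f_alt; elim: t s => [|c t IH] s /=; first exact: f_alt.
by rewrite f_alt -cat_rcons IH cat_rcons -f_alt.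
Qed.

Lemma map_tperm_id a b l : a \notin l -> b \notin l -> map (tperm a b) l = l.
Proof.
move=> al bl; apply: map_id_in => c cl.
by rewrite tpermD //; [apply: contraNneq al => ->|apply: contraNneq bl => ->].
Qed.

Lemma alternating_tperm f a b l : alternating f -> uniq l ->
  a != b -> a \in l -> b \in l -> f (map (tperm a b) l) = - f l.
Proof.
move=> f_alt; suff wl: forall a b s t u, uniq (s ++ a :: t ++ b :: u) ->
   f (map (tperm a b) (s ++ a :: t ++ b :: u)) = - f (s ++ a :: t ++ b :: u).
  move=> ul ab al bl; case/splitPr: al ul bl => s t ul.
  rewrite mem_cat inE eq_sym (negPf ab) /=; case/orP => /splitPr bl.
    case: bl ul => s1 s2 ul; rewrite -catA /= in ul *; rewrite tpermC.
    exact: wl.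
  by case: bl ul => t1 t2 ul; apply: wl.
move=> {a b l}a b s t u ul.
have: uniq [:: a, b & s ++ t ++ u].
  rewrite -(perm_uniq (s1 := s ++ a :: t ++ b :: u)) //.
  by apply/seq.permP => p; rewrite /= !count_cat /= !count_cat /= !addnA; ring.
rewrite /= inE !mem_cat !negb_or => /andP[/and4P[ab as_ at_ au]] /andP[/and3P[bs
  bt bu] _].
rewrite map_cat /= map_cat /= !map_tperm_id // tpermL tpermR.
by rewrite alternating_swap.
Qed.

(** Factor [s] into transpositions, each of which costs a sign. Applied to a [wedges] of all the
    letters, this computes signatures. *)
Lemma alternating_perm f l (s : {perm I}) : alternating f ->
  uniq l -> (forall a, a \in l) -> f (map s l) = (-1) ^+ s * f l.
Proof.
move=> f_alt; have [ts -> dts] := prod_tpermP s.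
elim: ts l dts => [|[a b] ts IH] l /=.
  rewrite big_nil odd_perm1 expr0 mul1r => _ _ _; congr f.
  by apply: map_id_in => a _; rewrite perm1.
rewrite big_cons /= => /andP[/= ab dts] ul al.
rewrite (_ : map _ l = map (\prod_(i <- ts) tperm i.1 i.2)%g (map (tperm a b)
  l)); last first.
  by rewrite -map_comp; apply: eq_map => c; rewrite permM.
rewrite IH // ?map_inj_uniq //; last 2 first.
- exact: perm_inj.
- by move=> c; rewrite -[c](tpermK a b) map_f.
rewrite alternating_tperm // odd_permM odd_tperm ab signr_addb.
by rewrite expr1 mulN1r mulNr mulrN.
Qed.

Lemma alternating_wedges m : alternating (wedges m).
Proof.
elim: m => [|a m IH] /=; last exact: alternating_wedge.
move=> s a b t; rewrite /= /unit_form.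
by case: s => [|c s] /=; rewrite oppr0.
Qed.

Lemma degree_wedges m : degree_eq (size m) (wedges m).
Proof.
elim: m => [|a m IH] /=; last exact: degree_wedge.
by move=> [|b l] //; rewrite /= /unit_form.
Qed.

Lemma wedge_neq0 a f l : wedge a f l != 0 ->
  exists s t, l = s ++ a :: t /\ f (s ++ t) != 0.
Proof.
elim: l f => [|b l IH] f /=; first by rewrite eqxx.
have [<-|ab] := eqVneq a b.
  have [fl|fl] := eqVneq (f l) 0; last by exists [::], l.
  rewrite fl sub0r oppr_eq0 => /IH[s [t [-> fst]]].
  by exists (a :: s), t.
rewrite sub0r oppr_eq0 => /IH[s [t [-> fst]]].
by exists (b :: s), t.
Qed.

Lemma wedges_perm m l : wedges m l != 0 -> perm_eq m l.
Proof.
elim: m l => [|a m IH] l /=.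
  by rewrite /unit_form; case: l => //= b l; rewrite eqxx.
case/wedge_neq0 => s [t [-> /IH mst]].
by rewrite perm_sym -cat1s perm_catCA /= perm_cons perm_sym.
Qed.

Lemma off_wedges (P : pred I) m : all (predC P) m -> off P (wedges m).
Proof.
move=> Pm l; apply: contraTeq => /wedges_perm/perm_has <-.
by rewrite -all_predC.
Qed.

Lemma contract_wedges y m l :
  contract y (wedges m) l =
  \sum_(j < size m) (-1) ^+ j * y (tnth (in_tuple m) j) *
     wedges (take j m ++ drop j.+1 m) l.
Proof.
elim: m l => [|a m IH] l /=.
  by rewrite big_ord0 contract0 // => -[|b k].
rewrite contract_wedge big_ord_recl /= expr0 mul1r drop0; congr (_ * _ + _).
rewrite (eq_wedge _ (g := fun l => \sum_(j < size m) ((-1) ^+ j * y (tnth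
  (in_tuple m) j)) *
     wedges (take j m ++ drop j.+1 m) l)); last by move=> k _; apply: IH.
rewrite (wedge_sum a) -sumrN; apply: eq_bigr => j _.
by rewrite !(tnth_nth a) /= /bump /= add1n exprS mulN1r !mulNr.
Qed.

Lemma wedges_cons a m l : uniq m -> a \in m ->
  wedges m (a :: l) = (-1) ^+ index a m * wedges (rem a m) l.
Proof.
elim: m l => //= b m IH l /andP[bm um]; rewrite inE.
have [-> _|ab /= am] := eqVneq a b.
  rewrite mul1r wedge0 ?subr0 // => k _.
  by apply: contraNeq bm => /wedges_perm/perm_mem->; rewrite mem_head.
rewrite (eq_wedge _ (g := fun l => (-1) ^+ index a m * wedges (rem a m) l));
  last first.
  by move=> k _; rewrite IH.
by rewrite mulr0n sub0r wedgeM exprS mulN1r mulNr.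
Qed.

Lemma wedge_cat a f s t : a \notin t ->
  wedge a f (s ++ t) = wedge a (fun m => f (m ++ t)) s.
Proof.
move=> at_; elim: s f => [|b s IH] f /=; last by rewrite IH.
apply/eqP; apply: contraNT at_ => /wedge_neq0[u [v [-> _]]].
by rewrite mem_cat mem_head orbT.
Qed.

Lemma wedge_off P a f g l : (forall m, ~~ has P m -> f m = g m) ->
  ~~ has P l -> wedge a f l = wedge a g l.
Proof.
elim: l f g => //= b l IH f g fg; rewrite negb_or => /andP[Pb Pl].
rewrite fg //; congr (_ - _); apply: IH => // m Pm.
by apply: fg; rewrite /= negb_or Pb.
Qed.

(** The letters of the two blocks cannot be exchanged, so only the product of the two minors
    survives. *)
Lemma wedges_cat m m' s t : ~~ has (mem m') s -> ~~ has (mem t) m ->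
  wedges (m ++ m') (s ++ t) = wedges m s * wedges m' t.
Proof.
elim: m s => [|a m IH] s /=.
  rewrite /unit_form; case: s => [|b s] /=; first by rewrite mul1r.
  rewrite negb_or mul0r => /andP[bm' _] _.
  by apply: contraNeq bm' => /wedges_perm/perm_mem->; rewrite mem_head.
move=> sm'; rewrite negb_or => /andP[at_ mt].
rewrite wedge_cat // mulrC -wedgeM.
by apply: wedge_off sm' => k km'; rewrite IH // mulrC.
Qed.

Lemma wedges_id m : uniq m -> wedges m m = 1.
Proof.
elim: m => [|a m IH] /=; first by rewrite /unit_form.
case/andP=> am um; rewrite eqxx IH // wedge0 ?subr0 // => k _.
by apply: contraNeq am => /wedges_perm/perm_mem->; rewrite mem_head.
Qed.

Fixpoint words k : seq (seq I) :=
  if k is k'.+1 then [seq a :: m | a <- enum I, m <- words k'] else [:: [::]].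

Lemma size_words k m : m \in words k -> size m = k.
Proof.
elim: k m => [|k IH] m /=; first by rewrite inE => /eqP->.
by case/allpairsP => -[a w] [/= _ /IH <- ->].
Qed.

(** Expansion in the standard basis, where each basis element occurs once for each ordering of its
    letters. *)
Lemma sum_wedges k f l : alternating f -> size l = k ->
  \sum_(m <- words k) f m * wedges m l = f l *+ k`!.
Proof.
elim: k f l => [|k IH] f l f_alt.
  by case: l => // _; rewrite big_seq1 /= /unit_form mulr1.
move=> sl; rewrite big_allpairs_dep /= big_enum /=.
transitivity (\sum_a wedge a (fun m => k`!%:R * f (a :: m)) l).
  apply: eq_bigr => a _; rewrite -wedge_sum; apply: eq_wedge => m.
  rewrite sl => -[sm]; rewrite (IH (fun m => f (a :: m))) ?mulr_natl //.
  exact: alternating_cons.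
under eq_bigr do rewrite wedgeM.
by rewrite -mulr_sumr wedge_contract_cons // sl mulr_natl -mulrnA -factS.
Qed.

End Alternating.

Arguments unit_form {K R I}.
Arguments wedges {K R I}.

(** * Exactness of the Koszul complex *)

Section EulerHomotopy.
Variables (K : fieldType) (charK0 : [pchar K] =i pred0).
Variables (R : comAlgType K) (I : finType).
Variables (x : I -> R) (o : I) (P : pred I) (D : I -> {additive R -> R}).
Variable (J : nat -> {additive R -> R}).
Hypothesis o_nP : ~~ P o.
(** Let $E=\sum_a (x_a-x_o)D_a$, over the $a\ne o$ outside [P], be the Euler operator in the
    differences. [D a] behaves as the partial derivative in $x_a$, and [J k] is a right inverse of
    $E+k$; a factor $x_b-x_o$ raises the weight by one, whence the shift of [k] in [JM]. *)
Hypothesis DM : forall a b r, a != o ->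
  D a (x b * r) = r *+ (a == b) + x b * D a r.
Hypothesis JM : forall k b r,
  ~~ P b -> b != o -> J k ((x b - x o) * r) = (x b - x o) * J k.+1 r.
Hypothesis JE : forall k r, (0 < k)%N ->
  \sum_(a | ~~ P a && (a != o)) (x a - x o) * D a (J k r) + J k r *+ k = r.

(** The primitive is $\sum_a (e_a-e_o)\wedge D_aJ_kf$: by the antiderivation rule its contraction
    with [x] is $(E+k)J_kf=f$. The vectors $e_a-e_o$ keep it in the kernel of contraction with
    $(1,\ldots,1)$. *)
Lemma euler_homotopy k (f : seq I -> R) : (0 < k)%N ->
    alternating f -> off P f -> degree_eq k f ->
    (forall l, contract (fun=> 1) f l = 0) -> (forall l, contract x f l = 0) ->
  exists g, [/\ alternating g, off P g, degree_eq k.+1 g,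
    forall l, contract (fun=> 1) g l = 0 & forall l, contract x g l = f l].
Proof.
move=> k_gt0 f_alt offf homf thf dxf.
pose f' l := J (size l) (f l).
have f'_alt : alternating f'.
  by move=> s a b t; rewrite /f' f_alt raddfN !size_cat.
have offf' : off P f' by move=> l Pl; rewrite /f' offf // raddf0.
have homf' : degree_eq k f' by move=> l sl; rewrite /f' homf // raddf0.
have thf' l : contract (fun=> 1) f' l = 0.
  by rewrite contract1 /f' /= -raddf_sum -contract1 thf raddf0.
(* As [f'] is killed by contraction with $(1,\ldots,1)$, each $x_b$ may be replaced by $x_b-x_o$,
   and [J] pulled out by [JM]. *)
have dxf' l : contract x f' l = 0.
  transitivity (contract (fun b => x b - x o) f' l).
    transitivity (contract x f' l - x o * contract (fun=> 1) f' l).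
      by rewrite thf' mulr0 subr0.
    rewrite contract1 /contract mulr_sumr -sumrB.
    by apply: eq_bigr => b _; rewrite mulrBl.
  rewrite /contract (eq_bigr (fun b => J (size l) ((x b - x o) * f (b :: l))));
    last first.
    move=> b _; rewrite /f' /=; have [Pb|Pb] := boolP (P b).
      by rewrite offf ?raddf0 ?mulr0 ?raddf0 //= Pb.
    by have [->|bo] := eqVneq b o; rewrite ?subrr ?mul0r ?raddf0 ?JM.
  rewrite -raddf_sum (_ : \sum__ _ = 0) ?raddf0 //.
  under eq_bigr do rewrite mulrBl; rewrite sumrB -mulr_sumr.
  by rewrite [X in X - _]dxf -contract1 thf mulr0 subr0.
pose h a l := D a (f' l).
have h_alt a : alternating (h a) by move=> s b c t; rewrite /h f'_alt raddfN.
have offh a : off P (h a) by move=> l Pl; rewrite /h offf' // raddf0.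
have homh a : degree_eq k (h a) by move=> l sl; rewrite /h homf' // raddf0.
have thh a l : contract (fun=> 1) (h a) l = 0.
  by rewrite contract1 /h -raddf_sum -contract1 thf' raddf0.
(* Apply [D a] to [dxf']; the Leibniz term is [f' (a :: l)]. *)
have dxh a l : a != o -> contract x (h a) l = - f' (a :: l).
  move=> ao; have /(congr1 (D a)) := dxf' l; rewrite raddf0 raddf_sum.
  under eq_bigr do rewrite (DM _ _ ao); rewrite big_split /=.
  rewrite (bigD1 a) //= eqxx big1 ?addr0 => [|b /negPf]; last first.
    by rewrite eq_sym => ->.
  by move/eqP; rewrite addrC addr_eq0 => /eqP.
pose Q := [pred a | ~~ P a && (a != o)].
exists (fun l => \sum_(a | Q a) (wedge a (h a) l - wedge o (h a) l)); split.
- move=> s b c t; rewrite -sumrN; apply: eq_bigr => a _.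
  by rewrite (alternating_wedge a (h_alt a)) (alternating_wedge o (h_alt a)) opprD.
- move=> l Pl; rewrite big1 // => a /andP[Pa _].
  by rewrite !(off_wedge _ (offh a)) ?subrr.
- move=> l sl; rewrite big1 // => a _.
  by rewrite !(degree_wedge _ (homh a)) ?subrr.
- move=> l; rewrite contract1 exchange_big big1 //= => a _.
  rewrite sumrB -(contract1 (wedge a (h a))) -(contract1 (wedge o (h a))).
  rewrite !contract_wedge !mul1r !wedge0 ?subrr // => m _; exact: thh.
move=> l.
have [sl|sl] := eqVneq (size l) k; last first.
  rewrite homf // contract0 // => m sm; rewrite big1 // => a _.
  by rewrite !(degree_wedge _ (homh a)) ?subrr // sm eqSS.
rewrite /contract; under eq_bigr do rewrite mulr_sumr.
rewrite exchange_big /= -[RHS](@JE k) // -sl -/(f' l).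
transitivity (\sum_(a | Q a) ((x a - x o) * h a l +
   (wedge a (fun m => f' (a :: m)) l - wedge o (fun m => f' (a :: m)) l))).
  apply: eq_bigr => a /andP[_ ao].
  transitivity (contract x (wedge a (h a)) l - contract x (wedge o (h a)) l).
    by rewrite /contract -sumrB; apply: eq_bigr => b _; rewrite mulrBr.
  have eqN b : wedge b (contract x (h a)) l = - wedge b (fun m => f' (a :: m)) l.
    by rewrite -wedgeN; apply: eq_wedge => m _; apply: dxh.
  by rewrite !contract_wedge !eqN; ring.
rewrite big_split /=; congr (_ + _).
rewrite sumrB -(wedge_contract_cons l f'_alt).
(* Contraction with $(1,\ldots,1)$ kills [f'], so the $\iota_af'$ with $a$ in [Q] add up to
   $-\iota_of'$. This supplies the term $a=o$ that the number operator lacks. *)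
have -> : \sum_(a | Q a) wedge o (fun m => f' (a :: m)) l =
   - wedge o (fun m => f' (o :: m)) l.
  transitivity (wedge o (fun m => \sum_(a | Q a) 1 * f' (a :: m)) l).
    by rewrite wedge_sum; apply: eq_bigr => a _; rewrite mul1r.
  rewrite -wedgeN; apply: eq_wedge => m _.
  have := thf' m; rewrite contract1 (bigD1 o) //= (bigID P) /=.
  rewrite big1 ?add0r => [|a /andP[_ Pa]]; last by rewrite offf' //= Pa.
  move/eqP; rewrite addrC addr_eq0 => /eqP <-.
  by apply: eq_big => a; rewrite ?mul1r // andbC.
rewrite opprK [RHS](bigD1 o) //= addrC; congr (_ + _).
rewrite [RHS](bigID P) /= [X in _ = X + _]big1 ?add0r => [|a /andP[_ Pa]];
  last first.
  by apply: wedge0 => m _; rewrite offf' //= Pa.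
by apply: eq_bigl => a; rewrite andbC.
Qed.

End EulerHomotopy.

(** * Operators that are diagonal on monomials *)

Section DiagonalOperator.
Variables (K : fieldType) (n : nat).
Notation R := {mpoly K[n]}.

Definition diagop (c : 'X_{1..n} -> K) (p : R) : R :=
  \sum_(m <- msupp p) (c m * p@_m) *: 'X_[m].

Lemma mcoeff_diagop c p m : (diagop c p)@_m = c m * p@_m.
Proof.
rewrite /diagop raddf_sum /=; under eq_bigr do rewrite mcoeffZ mcoeffX.
have [mp|mp] := boolP (m \in msupp p).
  rewrite (bigD1_seq m) //= eqxx mulr1 big1 ?addr0 // => k /negPf->.
  by rewrite mulr0.
rewrite (memN_msupp_eq0 mp) mulr0 big_seq big1 // => k kp.
by rewrite [_ == _](negPf _) ?mulr0 //; apply: contraNneq mp => <-.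
Qed.

Lemma diagop_linear c : linear (diagop c).
Proof.
move=> a p q; apply/mpolyP => m.
by rewrite !(mcoeffD, mcoeffZ, mcoeff_diagop) mulrDr mulrCA.
Qed.

HB.instance Definition _ c := GRing.isLinear.Build K R R _ (diagop c)
  (diagop_linear c).

Lemma diagopX c m : diagop c 'X_[m] = c m *: 'X_[m].
Proof.
apply/mpolyP => k; rewrite mcoeff_diagop mcoeffZ mcoeffX.
by case: eqP => [->|] //; rewrite !mulr0.
Qed.

End DiagonalOperator.

(** * The Koszul complex on the differences of the variables *)

Section KoszulExact.
Variables (K : fieldType) (charK0 : [pchar K] =i pred0) (n : nat).
Notation R := {mpoly K[n]}.
Variables (o : 'I_n) (P : pred 'I_n).
Hypothesis o_nP : ~~ P o.

Local Definition Q := [pred a | ~~ P a && (a != o)].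

Local Definition weight (m : 'X_{1..n}) := (\sum_(a | Q a) m a)%N.

(** Inverse of the Euler operator of the variables in [Q], plus [k]. At [k = 0] the monomials of
    weight 0 are killed, since 0 has inverse 0. *)
Local Definition invop k (p : R) := diagop (fun m => (weight m + k)%:R^-1 : K) p.

Let invop_linear k : linear (invop k).
Proof. exact: linearP. Qed.

HB.instance Definition _ k := GRing.isLinear.Build K R R _ (invop k)
  (invop_linear k).

Let invopM k b p : Q b -> invop k ('X_b * p) = 'X_b * invop k.+1 p.
Proof.
move=> Qb; elim/mpolyind: p => [|c m p _ _ IH]; first by rewrite !(mulr0, raddf0).
rewrite mulrDr !raddfD /= mulrDr IH; congr (_ + _).
rewrite -scalerAr !linearZ /= -scalerAr; congr (_ *: _).
rewrite -mpolyXD /invop !diagopX -scalerAr -mpolyXD; congr (_%:R^-1 *: _).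
rewrite addnS -addSn; congr (_ + _)%N.
rewrite /weight (bigD1 b) //= [in RHS](bigD1 b) //= mnmDE mnm1E eqxx add1n addSn.
congr (_ + _).+1; apply: eq_bigr => a /andP[_ ab].
by rewrite mnmDE mnm1E eq_sym (negPf ab).
Qed.

Let euler p : \sum_(a | Q a) 'X_a * mderiv a p = diagop (fun m => (weight m)%:R :
  K) p.
Proof.
elim/mpolyind: p => [|c m p _ _ IH].
  by rewrite raddf0 big1 // => a _; rewrite mderiv0 mulr0.
under eq_bigr do rewrite mderivD mulrDr; rewrite big_split /= IH raddfD /=;
  congr (_ + _).
rewrite linearZ /= diagopX natr_sum scaler_suml scaler_sumr; apply: eq_bigr => a _.
rewrite mderivZ mderivX -!scalerAr; congr (_ *: _).
have [->|ma] := eqVneq (m a) 0%N; first by rewrite !scale0r.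
by rewrite -mpolyXD addmC submK // lep1mP.
Qed.

Let invopE k p : (0 < k)%N ->
  \sum_(a | Q a) 'X_a * mderiv a (invop k p) + invop k p *+ k = p.
Proof.
case: k => // k _; rewrite euler; apply/mpolyP => m.
rewrite mcoeffD mcoeffMn /invop !mcoeff_diagop -[X in _ + X]mulr_natl -mulrDl
  -natrD mulrA.
by rewrite addnS mulfV ?mul1r // (natK_neq0 charK0).
Qed.

(** [phi false] and [phi true] are the mutually inverse substitutions $x_i\mapsto x_i-x_o$ and
    $x_i\mapsto x_i+x_o$ for $i\ne o$. The second turns the difference $x_i-x_o$ into the variable
    $x_i$. *)
Local Definition phi (e : bool) (p : R) : R :=
  p \mPo [tuple (if i == o then 'X_i else 'X_i - (-1) ^+ e *: 'X_o) | i < n].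

Let phi_lin e : linear (phi e).
Proof. exact: linearP. Qed.

HB.instance Definition _ e := GRing.isLinear.Build K R R _ (phi e) (phi_lin e).

Let phiM e p q : phi e (p * q) = phi e p * phi e q.
Proof. exact: rmorphM. Qed.

Let phiX e b : phi e 'X_b = if b == o then 'X_b else 'X_b - (-1) ^+ e *: 'X_o.
Proof. by rewrite /phi comp_mpolyXU -tnth_nth tnth_mktuple. Qed.

Let phi_y e b : b != o -> phi e ('X_b - (-1) ^+ (~~ e) *: 'X_o) = 'X_b.
Proof.
move=> bo; rewrite raddfB /= linearZ /= !phiX (negPf bo) eqxx.
by case: e; rewrite /= ?expr0 ?expr1 ?scaleN1r ?scale1r ?opprK ?addrK ?subrK.
Qed.

Let phiK e p : phi e (phi (~~ e) p) = p.
Proof.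
elim/mpolyind: p => [|c m p _ _ IH]; first by rewrite !raddf0.
rewrite !raddfD /= IH !linearZ /=; congr (_ *: _ + _).
rewrite mpolyXE_id /phi !rmorph_prod; apply: eq_bigr => i _ /=.
rewrite !rmorphXn -!/(phi _ _) /= -/(phi (~~ e) 'X_i); congr (_ ^+ _).
rewrite -[LHS]/(phi e (phi (~~ e) 'X_i)) phiX.
case: eqP => [->|/eqP io]; first by rewrite phiX eqxx.
exact: phi_y.
Qed.

Local Definition D (a : 'I_n) (p : R) := phi false (mderiv a (phi true p)).
Local Definition J k (p : R) := phi false (invop k (phi true p)).

Let D_lin a : linear (D a).
Proof. by move=> c p q; rewrite /D linearP mderivD mderivZ linearP. Qed.

Let J_lin k : linear (J k).
Proof. by move=> c p q; rewrite /J !linearP. Qed.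

HB.instance Definition _ a := GRing.isLinear.Build K R R _ (D a) (D_lin a).
HB.instance Definition _ k := GRing.isLinear.Build K R R _ (J k) (J_lin k).

(** The kernel of contraction with $(1,\ldots,1)$ is the exterior algebra on the $e_a-e_o$, on which
    contraction with the variables is the Koszul differential of the $x_a-x_o$. Conjugation by [phi]
    makes these differences variables, and provides the operators required by [euler_homotopy]. *)
Theorem koszul_exact k (f : seq 'I_n -> R) : (0 < k)%N ->
    alternating f -> off P f -> degree_eq k f ->
    (forall l, contract (fun=> 1) f l = 0) ->
    (forall l, contract (fun a => 'X_a) f l = 0) ->
  exists g, [/\ alternating g, off P g, degree_eq k.+1 g,
    forall l, contract (fun=> 1) g l = 0 &
    forall l, contract (fun a => 'X_a) g l = f l].
Proof.
move=> k_gt0; apply: (euler_homotopy (o := o) (D := fun a => D a : {additive R ->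
  R})
  (J := fun k => J k : {additive R -> R})) => //.
- move=> a b r ao /=; rewrite /D phiM mderivM raddfD /= !phiM !(phiK false).
  have -> : mderiv a (phi true 'X_b) = (a == b)%:R.
    rewrite phiX; case: (eqVneq b o) => [->|bo]; last rewrite mderivB mderivZ.
      by rewrite mderivX mnm1E eq_sym (negPf ao) scale0r.
    rewrite !mderivX !mnm1E ![_ == a]eq_sym (negPf ao) scale0r scaler0 subr0.
    case: eqP => [->|]; rewrite ?scale0r // scale1r -[RHS]mpolyX0; congr 'X_[_].
    by apply/mnmP => c; rewrite mnmBE subnn mnm0E.
  rewrite -[X in _ = X + _]mulr_natl; congr (_ * _ + _).
  by case: (a == b); rewrite ?raddf0 // /phi rmorph1.
- move=> i b r Pb bo; rewrite /= /J phiM -[X in phi true (_ - X)]scale1r.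
  rewrite phi_y // invopM ?phiM; last by apply/andP.
  by rewrite phiX (negPf bo) expr0 scale1r.
move=> i r i0; rewrite /= /J -[RHS](phiK false) -[in RHS](invopE (phi true r) i0).
rewrite raddfD /= raddfMn; congr (_ + _); rewrite [RHS]raddf_sum.
apply: eq_bigr => a /andP[_ ao].
by rewrite /= phiM /D phiX (negPf ao) expr0 scale1r (phiK true).
Qed.

End KoszulExact.

Lemma perm_eq_enum_perm n (l1 l2 : seq 'I_n) :
  perm_eq l1 (enum 'I_n) -> perm_eq l2 (enum 'I_n) ->
  exists s : 'S_n, map s l1 = l2.
Proof.
move=> l1E l2E.
have u1 : uniq l1 by rewrite (perm_uniq l1E) enum_uniq.
have u2 : uniq l2 by rewrite (perm_uniq l2E) enum_uniq.
have s12 : size l1 = size l2 by rewrite (perm_size l1E) (perm_size l2E).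
have m1 x : x \in l1 by rewrite (perm_mem l1E) mem_enum.
pose f x := nth x l2 (index x l1).
have f_inj : injective f.
  move=> x y; rewrite /f (set_nth_default y) -?s12 ?index_mem // => /eqP.
  by rewrite nth_uniq -?s12 ?index_mem // => /eqP/index_inj->.
exists (perm f_inj).
case: l1 l2 @f f_inj {l1E l2E u2} u1 s12 m1 => [|x l1] [|y l2] // f f_inj u1 s12 m1.
apply: (@eq_from_nth _ x) => [|i]; rewrite size_map // => il.
rewrite (nth_map x) // permE /f index_uniq //.
by apply: set_nth_default; rewrite -s12.
Qed.

Lemma card_notin n (l : seq 'I_n) : uniq l -> #|[pred a | a \notin l]| = (n -
  size l)%N.
Proof.
move=> ul; have := cardC (mem l); rewrite card_ord (card_uniqP ul) => cardl.
apply: (@addnI (size l)); rewrite [LHS]cardl subnKC //.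
by rewrite (leq_trans (leq_addr _ _) (eq_leq cardl)).
Qed.

(** * Deleting a letter, and the top exterior degree *)

Section Restriction.
Variables (K : fieldType) (charK0 : [pchar K] =i pred0).
Variables (R : comAlgType K) (n : nat).
Notation I := 'I_n.
Implicit Types (f : seq I -> R) (a : I) (l s : seq I).

Lemma alternating_off f a : alternating f -> (forall l, f (a :: l) = 0) ->
  off (pred1 a) f.
Proof.
move=> f_alt fa l; rewrite has_pred1 => /splitPr[s t].
elim/last_ind: s t => [|s b IH] t; first exact: fa.
by rewrite cat_rcons f_alt IH oppr0.
Qed.

Definition restrict a f l := if a \in l then 0 else f l.

Lemma alternating_restrict a f : alternating f -> alternating (restrict a f).
Proof.
move=> f_alt s b c t; rewrite /restrict !mem_cat !inE.
by rewrite [(a == b) || _]orbCA f_alt; case: ifP => _; rewrite ?oppr0 ?opprK.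
Qed.

Lemma off_restrict a f : off (pred1 a) (restrict a f).
Proof. by move=> l; rewrite has_pred1 /restrict => ->. Qed.

Lemma degree_restrict k a f : degree_eq k f -> degree_eq k (restrict a f).
Proof. by move=> df l sl; rewrite /restrict df ?if_same. Qed.

(** A word of [k] distinct letters survives the restriction exactly for the [n - k] letters that it
    misses. *)
Lemma sum_restrict k f l : alternating f -> degree_eq k f ->
  \sum_a restrict a f l = f l *+ (n - k).
Proof.
move=> f_alt df; have [ul|/(alternating_uniq charK0 f_alt) fl] := boolP (uniq l);
  last first.
  by rewrite fl mul0rn big1 // => a _; rewrite /restrict fl if_same.
have [<-|sl] := eqVneq (size l) k; last first.
  by rewrite df // mul0rn big1 // => a _; rewrite (degree_restrict _ df).
rewrite (bigID (mem l)) /= big1 ?add0r => [|a al]; last by rewrite /restrict al.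
rewrite (eq_bigr (fun=> f l)) => [|a /negPf al]; last by rewrite /restrict al.
by rewrite sumr_const card_notin.
Qed.

(** Contraction with $(1,\ldots,1)$ is exact, and $e_o\wedge f$ is an explicit primitive. *)
Lemma contract1_wedge o f : (forall l, contract (fun=> 1) f l = 0) ->
  forall l, contract (fun=> 1) (wedge o f) l = f l.
Proof.
by move=> thf l; rewrite contract_wedge mul1r wedge0 ?subr0.
Qed.

Definition volume : seq I -> R := wedges (enum I).

Lemma alternating_volume : alternating volume.
Proof. exact: alternating_wedges. Qed.

Lemma degree_volume : degree_eq n volume.
Proof. by rewrite -[X in degree_eq X](size_enum_ord n); apply: degree_wedges. Qed.

Lemma alternating_top f l : alternating f -> degree_eq n f ->
  f l = f (enum I) * volume l.
Proof.
move=> f_alt df; have [ul|ul] := boolP (uniq l); last first.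
  rewrite [f l](alternating_uniq charK0 f_alt ul).
  by rewrite (alternating_uniq charK0 alternating_volume ul) mulr0.
have [sl|sl] := eqVneq (size l) n; last by rewrite df ?degree_volume ?mulr0.
have lE : perm_eq l (enum I).
  apply: uniq_perm (enum_uniq _) _ => //.
  have [|//|_ //] := @uniq_min_size _ l (enum I) ul.
    by move=> a; rewrite mem_enum.
  by rewrite size_enum_ord sl.
have al a : a \in l by rewrite (perm_mem lE) mem_enum.
have [p <-] := perm_eq_enum_perm (perm_refl (enum I)) lE.
have memE a : a \in enum I by rewrite mem_enum.
rewrite (alternating_perm p f_alt (enum_uniq _) memE).
rewrite (alternating_perm p alternating_volume (enum_uniq _) memE).
by rewrite /volume wedges_id ?enum_uniq // mulr1 mulrC.
Qed.

End Restriction.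

Arguments volume {K R n}.

(** * Specht forms *)

Section SpechtForms.
Variables (K : fieldType) (charK0 : [pchar K] =i pred0) (n : nat).
Notation R := {mpoly K[n]}.
Notation I := 'I_n.
Notation X := (fun a : I => 'X_a : R).
Implicit Types (z : I -> I -> seq I -> R) (u w : I -> seq I -> R).
Implicit Types (p q r b : I) (l : seq I).

(** These are the equations of James's kernel intersection theorem, read on coefficients: [sf_alt]
    comes from merging two rows of length one, [sf_cyc] from moving the entry of the third row to
    the second, [sf_sum] from moving an entry of the second row to the first. *)
Record specht_form h z : Prop := SpechtForm {
  sf_alt : forall p q, alternating (z p q);
  sf_sym : forall p q l, z p q l = z q p l;
  sf_diag : forall p l, z p p l = 0;
  sf_cyc : forall p q r l, z p q (r :: l) + z q r (p :: l) + z r p (q :: l) = 0;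
  sf_sum : forall p l, \sum_q z p q l = 0;
  sf_deg : forall p q, degree_eq h (z p q) }.

Record specht_lift k u : Prop := SpechtLift {
  sl_alt : forall p, alternating (u p);
  sl_off : forall p, off (pred1 p) (u p);
  sl_contract : forall p l, contract (fun=> 1) (u p) l = 0;
  sl_sum : forall l, \sum_p u p l = 0;
  sl_deg : forall p, degree_eq k (u p) }.

Definition form_of u p q l : R := u p (q :: l) + u q (p :: l).

(** In the cyclic relation the six terms cancel in pairs by alternation; the row sum vanishes by
    [sl_contract] and [sl_sum]. *)
Lemma form_of_lift h u : specht_lift h.+1 u -> specht_form h (form_of u).
Proof.
move=> [u_alt u_off u_th u_sum u_deg]; split.
- by move=> p q s a b t; rewrite /form_of (u_alt p (q :: s)) (u_alt q (p :: s))
  opprD.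
- by move=> p q l; rewrite /form_of addrC.
- by move=> p l; rewrite /form_of !(u_off p) ?addr0 //= eqxx.
- move=> p q r l; rewrite /form_of (alternating2 q r _ (u_alt p)).
  by rewrite (alternating2 r p _ (u_alt q)) (alternating2 p q _ (u_alt r)); ring.
- move=> p l; rewrite /form_of big_split /= -contract1 u_th add0r.
  exact: u_sum.
by move=> p q l sl; rewrite /form_of !u_deg ?addr0 //= eqSS.
Qed.

(** Sum the cyclic relation over [r]: two of its three sums vanish by [sf_sum]. *)
Lemma sf_contract1 h z p q l : specht_form h z -> contract (fun=> 1) (z p q) l = 0.
Proof.
move=> [_ z_sym _ z_cyc z_sum _]; rewrite contract1.
have: \sum_r (z p q (r :: l) + z q r (p :: l) + z r p (q :: l)) = 0.
  by rewrite big1 // => r _; apply: z_cyc.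
rewrite !big_split /= z_sum addr0.
by under [X in _ + X]eq_bigr do rewrite z_sym; rewrite z_sum addr0.
Qed.

(* The lift averages the ways to move an entry of [l] back to the pair [p, q]. *)
Lemma lift_of_form h z : specht_form h z ->
  exists2 u, specht_lift h.+1 u & forall p q l, z p q l = form_of u p q l.
Proof.
move=> zf; have [z_alt z_sym z_diag z_cyc z_sum z_deg] := zf.
pose v p l := \sum_b wedge b (z p b) l.
have v_form p q l : v p (q :: l) + v q (p :: l) = z p q l *+ h.+2.
  have vE p' q' : v p' (q' :: l) =
      z p' q' l - \sum_b wedge b (fun m => z p' b (q' :: m)) l.
    rewrite /v sumrB; congr (_ - _).
    rewrite (bigD1 q') //= eqxx big1 ?addr0 // => b /negPf.
    by move=> ->.
  rewrite !vE (z_sym q p) addrACA -opprD -big_split /=.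
  have [sl|sl] := eqVneq (size l) h; last first.
    rewrite z_deg // mul0rn addr0 big1 ?oppr0 ?addr0 // => b _.
    rewrite !wedge0 ?addr0 // => m sm; apply: z_deg.
      by rewrite /= sm.
    by rewrite /= sm.
  (* The cyclic relation turns the two correction terms into the number operator on [z p q]. It
     contributes [h], which with the two leading terms gives the factor [h.+2]. *)
  rewrite (eq_bigr (fun b => - wedge b (fun m => z p q (b :: m)) l)).
    by rewrite sumrN opprK wedge_contract_cons // sl !mulrS addrA.
  move=> b _; rewrite -wedgeN -wedgeD; apply: eq_wedge => m _.
  apply/eqP; rewrite -addr_eq0 -(z_cyc p q b m) (z_sym b p); apply/eqP; ring.
have v_alt p : alternating (v p).
  move=> s a b t; rewrite -sumrN; apply: eq_bigr => c _.
  exact: alternating_wedge.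
exists (fun p l => h.+2%:R^-1 *: v p l); last first.
  move=> p q l; rewrite /form_of -scalerDr v_form -scaler_nat scalerA mulVf
    ?scale1r //.
  exact: natK_neq0.
have scl f : (forall l : seq I, f l = 0 :> R) -> forall l, h.+2%:R^-1 *: f l = 0.
  by move=> f0 l; rewrite f0 scaler0.
split.
- by move=> p s a b t; rewrite v_alt scalerN.
- move=> p; apply: alternating_off.
    by move=> s a b t; rewrite v_alt scalerN.
  apply: scl => l; have := v_form p p l; rewrite z_diag mul0rn -mulr2n.
  exact: mulrnI0.
- move=> p l; rewrite contractZ; apply: scl => {}l.
  rewrite contract1 exchange_big /= -[RHS](z_sum p l); apply: eq_bigr => b _.
  rewrite -(contract1 (wedge b (z p b))) contract_wedge mul1r wedge0 ?subr0 // =>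
    m _.
  exact: sf_contract1 zf.
- move=> l; rewrite -scaler_sumr; apply: (scl (fun l => \sum_p v p l)) => {}l.
  rewrite exchange_big big1 // => b _.
  transitivity (wedge b (fun m => \sum_(p < n) 1 * z p b m) l).
    by rewrite wedge_sum; apply: eq_bigr => p _; rewrite mul1r.
  apply: wedge0 => m _; under eq_bigr do rewrite mul1r z_sym.
  exact: z_sum.
move=> p l sl; rewrite /v big1 ?scaler0 // => b _.
by apply: degree_wedge sl; apply: z_deg.
Qed.

(** The shape would be $(1,2,1^h)$, not a partition. Only three letters lie outside [l], so each row
    sum has two terms and changes the sign from one edge of a triangle to the next; going round the
    three edges gives $z=-z$. *)
Lemma specht_form_top_eq0 h z p q l : h.+3 = n -> specht_form h z -> z p q l = 0.
Proof.
move=> hn zf; have [z_alt z_sym z_diag z_cyc z_sum z_deg] := zf.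
have [sl|] := eqVneq (size l) h; last exact: z_deg.
have [ul|] := boolP (uniq l); last exact: (alternating_uniq charK0 (z_alt p q)).
have [->|pq] := eqVneq p q; first exact: z_diag.
have z_off1 d e : d \in l -> z d e l = 0.
  have zoff : off (pred1 d) (z d e).
    apply: alternating_off => // m; have := z_cyc e d d m.
    rewrite z_diag addr0 (z_sym e d) -mulr2n; exact: mulrnI0.
  by move=> dl; apply: zoff; rewrite has_pred1.
have [pl|pl] := boolP (p \in l); first exact: z_off1.
have [ql|ql] := boolP (q \in l); first by rewrite z_sym; apply: z_off1.
have uql : uniq [:: p, q & l] by rewrite /= inE negb_or pq pl ql ul.
have [j jE] : exists j, [predC [:: p, q & l]] =i pred1 j.
  apply/card1P.
  rewrite -(eqn_add2l #|[:: p, q & l]|) cardC card_ord (card_uniqP uql) /= sl.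
  by rewrite -hn addn1.
have := jE j; rewrite !inE eqxx !negb_or => /and3P[jp jq jl].
have row a b c : uniq [:: a; b; c] -> {subset [:: p; q; j] <= [:: a; b; c]} ->
    z a b l = - z a c l.
  rewrite /= !inE negb_or andbT => /andP[/andP[ab ac] bc] sub.
  apply/eqP; rewrite -addr_eq0 -(z_sum a l) (bigD1 a) //= z_diag add0r.
  rewrite (bigD1 b) 1?eq_sym //= (bigD1 c) ?[c == _]eq_sym ?ac //=.
  rewrite big1 ?addr0 // => d /andP[/andP[da db] dc]; rewrite z_sym; apply: z_off1.
  have dN : d \notin [:: p; q; j].
    by apply: contraTN dc => /sub; rewrite !inE (negPf da) (negPf db) /= => ->.
  apply: contraNT dN => dl; rewrite !inE.
  have := jE d; rewrite !inE !negb_or dl andbT => <-.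
  by case: (d == p); case: (d == q).
apply: eqrN_eq0 => //; rewrite {1}(row p q j); first last.
- by [].
- by rewrite /= !inE negb_or pq eq_sym jp eq_sym jq.
rewrite z_sym (row j p q) ?opprK; first last.
- by move=> d; rewrite !inE orbA orbC.
- by rewrite /= !inE negb_or jp jq pq.
rewrite z_sym (row q j p) 1?z_sym //.
- by rewrite /= !inE negb_or eq_sym jq eq_sym pq jp.
- by move=> d; rewrite !inE orbC -orbA.
Qed.

(** On Specht forms of degree 0 the first condition is void, and the second one expresses the kernel
    of $\partial_1$. *)
Definition koszul_cycle h z : Prop :=
  (forall p q l, contract X (z p q) l = 0) /\ (h = 0%N -> \sum_p \sum_q 'X_p *
    'X_q * z p q [::] = 0).

(** For any lift $u$, the cycle condition makes $(p,l)\mapsto du_p(l)$ alternating in the whole word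
    $p\,l$, hence a Koszul cycle. A primitive $g$ of it corrects $u$. *)
Lemma koszul_cycle_lift h z : (1 < n)%N -> specht_form h z -> koszul_cycle h z ->
  exists u, [/\ specht_lift h.+1 u, forall p q l, z p q l = form_of u p q l &
    forall p l, contract X (u p) l = 0].
Proof.
move=> n_gt1 zf [dz ez]; have [u ul zu] := lift_of_form zf.
have [u_alt u_off u_th u_sum u_deg] := ul.
pose v l := if l is p :: m then contract X (u p) m else 0.
have du_anti p q l : contract X (u p) (q :: l) = - contract X (u q) (p :: l).
  apply/eqP; rewrite -addr_eq0 -oppr_eq0 -(dz p q l) /contract -big_split -sumrN.
  apply/eqP; apply: eq_bigr => r _ /=; rewrite zu /form_of.
  by rewrite (alternating2 r q _ (u_alt p)) (alternating2 r p _ (u_alt q)); ring.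
have v_alt : alternating v.
  move=> [|c s] a b t /=; first exact: du_anti.
  exact: (alternating_contract _ (u_alt c)).
have v_th l : contract (fun=> 1) v l = 0.
  rewrite contract1 /= /contract exchange_big big1 // => a _.
  by rewrite -mulr_sumr u_sum mulr0.
have dv l : contract X v l = 0.
  case: l => [|q l]; last first.
    rewrite -[RHS]oppr0 -(contract_contract charK0 X l (u_alt q)) /contract -sumrN.
    by apply: eq_bigr => p _; rewrite -mulrN; congr (_ * _); apply: du_anti.
  (* At the empty word the contraction of [v] vanishes by degree if [h] is positive; for [h = 0],
     twice it is the evaluation of [z]. *)
  have [h0|h0] := eqVneq h 0%N; last first.
    rewrite {1}/contract big1 // => p _; rewrite /= contract0 ?mulr0 // => m sm.
    by apply: u_deg; rewrite sm eqSS eq_sym.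
  apply: (@mulrnI0 _ charK0 _ 1); rewrite -{}ez // mulr2n.
  under [RHS]eq_bigr do under eq_bigr do rewrite zu /form_of mulrDr.
  under [RHS]eq_bigr do rewrite big_split /=.
  rewrite big_split /=; congr (_ + _); last rewrite exchange_big.
    by apply: eq_bigr => p _; rewrite mulr_sumr; apply: eq_bigr => r _;
      rewrite mulrA.
  by apply: eq_bigr => p _; rewrite mulr_sumr; apply: eq_bigr => r _;
    rewrite mulrA ['X_r * _]mulrC.
have v_deg : degree_eq h.+1 v.
  by move=> [|p l] //=; rewrite eqSS => sl; apply: (degree_contract _ (u_deg p)).
have [||g [g_alt _ g_deg g_th dg]] :=
  koszul_exact charK0 (o := Ordinal n_gt1) (P := pred0) _ (ltn0Sn h) v_alt _
    v_deg v_th dv.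
- by [].
- by move=> l; rewrite has_pred0.
(* The added term cancels in [form_of], since [g] alternates, and contracts to minus
   [v (p :: l)]. *)
exists (fun p l => u p l + g (p :: l)); split.
- split.
  + move=> p s a b t; rewrite (u_alt p) opprD; congr (_ + _).
    exact: (g_alt (p :: s)).
  + move=> p; apply: alternating_off => [s a b t|l].
      rewrite (u_alt p) opprD; congr (_ + _); exact: (g_alt (p :: s)).
    by rewrite (u_off p) ?add0r /= ?eqxx // (alternating_mem charK0) ?mem_head.
  + move=> p l; rewrite contractD u_th add0r.
    rewrite -[RHS]oppr0 -(g_th (p :: l)) /contract -sumrN; apply: eq_bigr => r _.
    by rewrite (alternating2 _ _ _ g_alt) mulrN.
  + by move=> l; rewrite big_split /= u_sum add0r -contract1 g_th.
  + by move=> p l sl; rewrite u_deg // add0r g_deg // eqSS.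
- by move=> p q l; rewrite zu /form_of (alternating2 p q _ g_alt); ring.
move=> p l; rewrite contractD -[contract X (u p) l]/(v (p :: l)) -dg.
rewrite /contract -big_split big1 // => r _ /=.
by rewrite (alternating2 p r _ g_alt) mulrN subrr.
Qed.

(* The primitives [w p] need not sum to zero, but their sum is a boundary.    *)
Lemma lift_boundary h u : (1 < n)%N -> specht_lift h.+1 u ->
    (forall p l, contract X (u p) l = 0) ->
  exists w s, [/\ forall p, alternating (w p), forall p, off (pred1 p) (w p),
    forall p, degree_eq h.+2 (w p), forall p l, contract (fun=> 1) (w p) l = 0 &
    forall p l, contract X (w p) l = u p l] /\
    [/\ alternating s, degree_eq h.+3 s, forall l, contract (fun=> 1) s l = 0 &
    forall l, contract X s l = \sum_p w p l].
Proof.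
move=> n_gt1 [u_alt u_off u_th u_sum u_deg] du.
have ex p : exists g, [/\ alternating g, off (pred1 p) g, degree_eq h.+2 g,
    forall l, contract (fun=> 1) g l = 0 & forall l, contract X g l = u p l].
  have [o po] : exists o, ~~ pred1 p o.
    have [->|p0] := eqVneq p (Ordinal n_gt1).
      by exists (Ordinal (ltnW n_gt1)).
    by exists (Ordinal n_gt1); rewrite eq_sym in p0.
  exact: (koszul_exact charK0 po (ltn0Sn h) (u_alt p) (u_off p) (u_deg p)).
have [w wP] := fin_all_exists ex.
have w_alt p : alternating (w p) by case: (wP p).
have [||||||s [s_alt _ s_deg s_th ds]] :=
  koszul_exact charK0 (o := Ordinal n_gt1) (P := pred0) (k := h.+2)
    (f := fun l => \sum_p w p l) _ (ltn0Sn _).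
- by [].
- by move=> t a b l; rewrite -sumrN; apply: eq_bigr => p _; apply: w_alt.
- by move=> l; rewrite has_pred0.
- by move=> l sl; rewrite big1 // => p _; case: (wP p) => _ _ ->.
- move=> l; rewrite contract1 exchange_big big1 // => p _.
  by rewrite -(contract1 (w p)); case: (wP p).
- move=> l; rewrite /contract; under eq_bigr do rewrite mulr_sumr.
  rewrite exchange_big -[RHS](u_sum l); apply: eq_bigr => p _.
  by case: (wP p) => _ _ _ _ <-.
exists w, s; split; last by [].
by split=> // p; case: (wP p).
Qed.

(** Take $t=e_o\wedge s$, delete each letter $p$ in turn and contract with $(1,\ldots,1)$. By
    [sum_restrict] the results add up to $(n-m-1)s$, and this factor is invertible exactly because
    [m.+2 <= n]. *)
Lemma split_sum m (s : seq I -> R) : (m.+2 <= n)%N -> alternating s ->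
    degree_eq m s -> (forall l, contract (fun=> 1) s l = 0) ->
  exists2 u, [/\ forall p, alternating (u p), forall p, off (pred1 p) (u p),
    forall p, degree_eq m (u p) & forall p l, contract (fun=> 1) (u p) l = 0] &
    forall l, \sum_p u p l = s l.
Proof.
move=> mn s_alt s_deg s_th.
have [k kE] : {k | (n - m.+1)%N = k.+1} by exists (n - m.+2)%N; rewrite subnSK.
pose o := Ordinal (leq_trans (ltn0Sn _) mn).
pose t := wedge o s; pose v p := restrict p t.
have t_alt : alternating t by apply: alternating_wedge.
have t_deg : degree_eq m.+1 t by apply: degree_wedge.
have v_alt p : alternating (v p) by apply: alternating_restrict.
exists (fun p l => k.+1%:R^-1 *: contract (fun=> 1) (v p) l).
  split.
  - by move=> p r a b l; rewrite (alternating_contract _ (v_alt p)) scalerN.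
  - by move=> p l pl; rewrite (off_contract _ (@off_restrict _ _ _ p t)) ?scaler0.
  - by move=> p l sl; rewrite (degree_contract _ (degree_restrict p t_deg))
    ?scaler0.
  - by move=> p l; rewrite contractZ contract_contract ?scaler0.
move=> l; rewrite -scaler_sumr.
apply/esym/natKV => //; rewrite -kE -(contract1_wedge o) //.
rewrite !contract1 exchange_big -sumrMnl; apply: eq_bigr => a _.
under [RHS]eq_bigr do rewrite mul1r.
by rewrite (sum_restrict charK0 _ t_alt t_deg).
Qed.

(** The primitive [s] has degree [h + 3], so the bound on [h] is what [split_sum] asks for;
    subtracting the contractions of the pieces gives primitives of the $u_p$ with sum zero. *)
Theorem specht_form_exact h z : (h + 5 <= n)%N -> specht_form h z ->
    koszul_cycle h z ->
  exists2 z', specht_form h.+1 z' & forall p q l, contract X (z' p q) l = z p q l.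
Proof.
rewrite addnC => hn zf dz.
have n_gt1 : (1 < n)%N by apply: leq_trans hn.
have [u [ul zu du]] := koszul_cycle_lift n_gt1 zf dz.
have [w [s [[w_alt w_off w_deg w_th dw] [s_alt s_deg s_th ds]]]] :=
  lift_boundary n_gt1 ul du.
have [v [v_alt v_off v_deg v_th] sv] := split_sum hn s_alt s_deg s_th.
pose w' p l := w p l - contract X (v p) l.
(* The sign compensates for moving the contracted letter past the first letter [q] or [p]. *)
exists (fun p q l => form_of (fun p l => - w' p l) p q l).
  apply: form_of_lift; split.
  - move=> p t a b l; rewrite /w' (w_alt p) (alternating_contract X (v_alt p)).
    by ring.
  - by move=> p l pl; rewrite /w' (w_off p) // (off_contract X (v_off p)) //
    subrr oppr0.
  - move=> p l; rewrite contractN contractD w_th add0r contractN.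
    by rewrite (contract_anticomm _ _ _ (v_alt p)) contract0 ?oppr0.
  - move=> l; rewrite sumrN sumrB -ds -(eq_contract X (fun m _ => sv m)).
    rewrite /contract; under [X in - (X - _)]eq_bigr do rewrite mulr_sumr.
    by rewrite exchange_big subrr oppr0.
  - move=> p l sl; rewrite /w' (w_deg p) // (degree_contract X (v_deg p)) //.
    by rewrite subrr oppr0.
have dw' p l : contract X (w' p) l = u p l.
  rewrite contractD dw contractN contract_contract ?subr0 //.
have w'_alt p : alternating (w' p).
  move=> t a b m; rewrite /w' (w_alt p) (alternating_contract X (v_alt p)).
  by rewrite opprD.
move=> p q l; rewrite zu /form_of -!dw' /contract -big_split.
apply: eq_bigr => r _ /=; rewrite (alternating2 q r _ (w'_alt p)).
by rewrite (alternating2 p r _ (w'_alt q)); ring.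
Qed.

Local Notation Vol := (volume : seq I -> R).

(** Closed formula for the form of $\partial_{n-2}(e(T)\otimes 1)$; see [last_value_form]. *)
Definition top_form p q l : R :=
  ('X_p - 'X_q) * contract X (contract (fun=> 1) Vol) [:: p, q & l].

(** Now [s] has degree $n-1$, so it is a multiple [r] of the contraction of the volume element with
    $(1,\ldots,1)$. The obstruction [r] is all that remains of [z]. *)
Theorem specht_form_exact_top h z : (h + 4 = n)%N -> specht_form h z ->
    koszul_cycle h z -> exists r : R, forall p q l, z p q l = r * top_form p q l.
Proof.
rewrite addnC => hn zf dz.
have n_gt1 : (1 < n)%N by rewrite -hn.
have [u [ul zu du]] := koszul_cycle_lift n_gt1 zf dz.
have [w [s [[w_alt w_off w_deg w_th dw] [s_alt s_deg s_th ds]]]] :=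
  lift_boundary n_gt1 ul du.
pose o := Ordinal n_gt1.
pose r := wedge o s (enum I).
have sE l : s l = r * contract (fun=> 1) Vol l.
  rewrite -(contract1_wedge o) // -contractM.
  apply: eq_contract => m _; apply: alternating_top => //.
    exact: alternating_wedge.
  by move=> k sk; apply: (degree_wedge _ s_deg); rewrite [h.+4]hn.
have O_alt : alternating Vol := @alternating_volume K _ n.
pose Om p l := contract (fun=> 1) (fun m => Vol (p :: m)) l.
have Om_alt p : alternating (Om p).
  by apply/alternating_contract/alternating_cons.
have OmN p l : Om p l = - contract (fun=> 1) Vol (p :: l).
  rewrite /Om /contract -sumrN; apply: eq_bigr => a _.
  by rewrite (alternating2 _ _ _ O_alt) mulrN.
(* By [OmN] the sum of the $x_p\,$[Om p] is minus the contraction with the variables of $s/r$, so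
   the correction cancels $\sum_p w_p=ds$. *)
pose w' p l := w p l + r * 'X_p * Om p l.
have w'_lift : specht_lift h.+2 w'.
  split.
  - by move=> p t a b l; rewrite /w' (w_alt p) (Om_alt p) mulrN -opprD.
  - move=> p; rewrite /w' => l pl; rewrite (w_off p) // add0r.
    rewrite /Om (off_contract (P := pred1 p)) ?mulr0 // => m pm.
    by apply: (alternating_mem charK0) => //; rewrite -has_pred1.
  - move=> p l; rewrite contractD contractM w_th add0r.
    by rewrite contract_contract ?mulr0 //; apply: alternating_cons.
  - move=> l; rewrite big_split /= -ds (eq_contract X (fun m _ => sE m)) contractM.
    under [X in _ + X]eq_bigr do rewrite -mulrA.
    rewrite -mulr_sumr -mulrDr -big_split big1 ?mulr0 // => p _ /=.
    by rewrite OmN mulrN subrr.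
  - move=> p l sl; rewrite /w' (w_deg p) // add0r.
    rewrite /Om (degree_contract (k := h.+2)) ?mulr0 //.
    apply: degree_cons => k sk; apply: degree_volume.
    by apply: contraNneq sk => ->; rewrite -hn.
exists (- r) => p q l.
have w'_alt := sl_alt w'_lift.
have uE p' m : u p' m = contract X (w' p') m - r * 'X_p' * contract X (Om p') m.
  by rewrite contractD contractM dw addrK.
(* The form of [w'] has degree $n-3$, where Specht forms vanish. *)
have w'0 : contract X (w' p) (q :: l) + contract X (w' q) (p :: l) = 0.
  rewrite -[RHS]oppr0 -[in RHS](@contract0 _ _ _ X (form_of w' p q) l) => [|m _];
    last first.
    by apply: specht_form_top_eq0 (form_of_lift w'_lift); rewrite -hn.
  rewrite /contract -big_split -sumrN; apply: eq_bigr => a _ /=.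
  rewrite /form_of (alternating2 q a _ (w'_alt p)) (alternating2 p a _ (w'_alt q)).
  by ring.
have OmE p' q' m : contract X (Om p') (q' :: m) =
    contract X (contract (fun=> 1) Vol) [:: p', q' & m].
  apply: eq_bigr => a _; rewrite OmN; congr (_ * _).
  by rewrite -(alternating2 a p' _ (alternating_contract _ O_alt)).
have anti := alternating2 q p l (alternating_contract X
  (alternating_contract (fun=> 1) O_alt)).
rewrite zu /form_of !uE addrACA w'0 add0r !OmE anti /top_form; ring.
Qed.

(** Contracting twice with the variables gives zero. In the evaluation, splitting $x_px_q(x_p-x_q)$
    leaves such a double contraction in each of the two sums. *)
Lemma top_form_cycle : koszul_cycle (n - 4) top_form.
Proof.
have O_alt : alternating Vol := @alternating_volume K _ n.
have c_alt := alternating_contract (fun=> 1) O_alt.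
have d_alt := alternating_contract X c_alt.
split=> [p q l|_].
  rewrite contractM (_ : contract _ _ _ = 0) ?mulr0 //.
  transitivity (contract X (contract X (contract (fun=> 1) Vol)) [:: p, q & l]).
    apply: eq_bigr => a _; congr (_ * _).
    rewrite (alternating2 a p _ d_alt) -(alternating_cons p d_alt [::] q a l).
    by [].
  exact: contract_contract.
pose k p q := contract X (contract (fun=> 1) Vol) [:: p; q].
have sq p : \sum_q 'X_q * k p q = 0.
  apply: oppr_inj; rewrite oppr0 -sumrN.
  transitivity (contract X (contract X (contract (fun=> 1) Vol)) [:: p]).
    by apply: eq_bigr => q _; rewrite /k (alternating2 p q _ d_alt) mulrN opprK.
  exact: contract_contract.
have sp q : \sum_p 'X_p * k p q = 0 by apply: (contract_contract charK0 X [:: q]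
  c_alt).
transitivity (\sum_p 'X_p ^+ 2 * \sum_q 'X_q * k p q -
   \sum_q 'X_q ^+ 2 * \sum_p 'X_p * k p q).
  under [X in _ = X - _]eq_bigr do rewrite mulr_sumr.
  under [X in _ = _ - X]eq_bigr do rewrite mulr_sumr.
  rewrite [X in _ = _ - X]exchange_big -sumrB; apply: eq_bigr => p _.
  by rewrite -sumrB; apply: eq_bigr => q _; rewrite /top_form -/(k p q); ring.
under eq_bigr do rewrite sq mulr0.
by under [X in _ - X]eq_bigr do rewrite sp mulr0; rewrite !big1_eq subrr.
Qed.

(** Contractions square to zero. For the evaluation, average $x_px_qx_rz_{pq}(r)$ over the rotations
    of $p,q,r$ and use [sf_cyc]. *)
Lemma koszul_cycle_contract h z : specht_form h.+1 z ->
  koszul_cycle h (fun p q => contract X (z p q)).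
Proof.
case=> z_alt z_sym z_diag z_cyc z_sum z_deg; split=> [p q l|_].
  exact: contract_contract.
apply: (@mulrnI0 _ charK0 _ 2).
pose S (s : I -> I -> I -> R) := \sum_p \sum_q \sum_r s p q r.
pose t p q r := 'X_p * 'X_q * 'X_r * z p q [:: r].
have rot s : S s = S (fun p q r => s q r p).
  by rewrite /S; under eq_bigr do rewrite exchange_big /=; rewrite exchange_big.
transitivity (S t *+ 3).
  congr (_ *+ 3); apply: eq_bigr => p _; apply: eq_bigr => q _.
  by rewrite /contract mulr_sumr; apply: eq_bigr => r _; rewrite mulrA.
have e1 := rot t; have e2 := rot (fun p q r => t q r p).
have -> : S t *+ 3 = S t + S (fun p q r => t q r p) + S (fun p q r => t r p q).
  by rewrite -e2 -e1 !mulrSr mulr0n add0r.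
rewrite /S -!big_split big1 // => p _; rewrite -!big_split big1 // => q _.
rewrite -!big_split big1 // => r _ /=.
transitivity ('X_p * 'X_q * 'X_r * (z p q [:: r] + z q r [:: p] + z r p [:: q])).
  by rewrite /t; ring.
by rewrite z_cyc mulr0.
Qed.

(** The form of the polytabloid with first column [a] and second column [b1], [b2]; see
    [polytabloid_eval]. *)
Definition gen_form (a : seq I) b1 b2 p q l : R :=
  form_of (fun p l => ((p == b2)%:R - (p == b1)%:R) *
                      contract (fun=> 1) (wedges a) l) p q l.

Lemma specht_form_gen h (a : seq I) b1 b2 : size a = h.+2 -> b1 \notin a -> b2
  \notin a ->
  specht_form h (gen_form a b1 b2).
Proof.
move=> sa b1a b2a; apply: form_of_lift;
  have a_alt : alternating (wedges a : seq I -> R) := alternating_wedges _ a.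
split=> [p s b c t|p l|p l|l|p l sl].
- by rewrite (alternating_contract _ a_alt) mulrN.
- have [pb pl|pb _] := boolP (p \in [:: b1; b2]); last first.
    by move: pb; rewrite !inE negb_or => /andP[/negPf-> /negPf->];
      rewrite subrr mul0r.
  rewrite (off_contract (P := pred1 p)) ?mulr0 //; apply: off_wedges.
  apply/allP => c ca /=; apply: contraTneq ca => ->.
  by move: pb; rewrite !inE => /orP[]/eqP->.
- by rewrite contractM contract_contract ?mulr0.
- rewrite -mulr_suml sumrB (bigD1 b2) //= eqxx big1 => [|p /negPf->] //.
  by rewrite (bigD1 b1) //= eqxx big1 => [|p /negPf->] //; rewrite subrr mul0r.
by rewrite (degree_contract _ (k := h.+1)) ?mulr0 // -sa; apply: degree_wedges.
Qed.

(** Moving the contraction past the letter of the lift, then past the contraction with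
    $(1,\ldots,1)$, costs two signs that cancel. It then acts on [wedges a], which is formula
    (ii). *)
Lemma contract_gen_form (a : seq I) b1 b2 p q l :
  contract X (gen_form a b1 b2 p q) l =
  \sum_(j < size a) (-1) ^+ j * 'X_(tnth (in_tuple a) j) *
     gen_form (take j a ++ drop j.+1 a) b1 b2 p q l.
Proof.
have a_alt : alternating (wedges a : seq I -> R) := alternating_wedges _ a.
have dE c m : contract X (fun k => contract (fun=> 1) (wedges a) (c :: k)) m =
    \sum_(j < size a) (-1) ^+ j * 'X_(tnth (in_tuple a) j) *
      contract (fun=> 1) (wedges (take j a ++ drop j.+1 a)) (c :: m).
  transitivity (- contract X (contract (fun=> 1) (wedges a)) (c :: m)).
    rewrite /contract -sumrN; apply: eq_bigr => r _; rewrite -mulrN.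
    by congr (_ * _); apply: (alternating_contract _ a_alt [::] c r m).
  rewrite (contract_anticomm _ _ _ a_alt) opprK -contract_sum.
  by apply: eq_contract => k _; apply: contract_wedges.
rewrite /gen_form /form_of contractD !contractM !dE !mulr_sumr -big_split.
by apply: eq_bigr => j _ /=; ring.
Qed.

(** Each of the two terms of [form_of] evaluates to the Specht polynomial. *)
Lemma eval_gen_form a1 a2 b1 b2 :
  \sum_p \sum_q 'X_p * 'X_q * gen_form [:: a1; a2] b1 b2 p q [::] =
  (('X_a1 - 'X_a2) * ('X_b1 - 'X_b2)) *+ 2.
Proof.
pose B p : R := (p == b2)%:R - (p == b1)%:R.
pose A p : R := contract (fun=> 1) (wedges [:: a1; a2]) [:: p].
have pick a : \sum_p 'X_p * (p == a)%:R = 'X_a :> R.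
  rewrite (bigD1 a) //= eqxx mulr1 big1 ?addr0 // => p /negPf->.
  by rewrite mulr0.
have AE p : A p = (p == a2)%:R - (p == a1)%:R.
  rewrite /A /wedges /= contract_wedge mul1r (eq_wedge _ (g := unit_form));
    last first.
    by move=> m [/size0nil->]; rewrite contract_wedge mul1r subr0.
  by rewrite /= /unit_form /= !subr0 (eq_sym p a1) (eq_sym p a2).
have sumX b c : \sum_p 'X_p * ((p == b)%:R - (p == c)%:R) = 'X_b - 'X_c :> R.
  by under eq_bigr do rewrite mulrBr; rewrite sumrB !pick.
transitivity (\sum_p \sum_q (('X_p * B p) * ('X_q * A q) + ('X_p * A p) * ('X_q *
  B q))).
  by apply: eq_bigr => p _; apply: eq_bigr => q _;
    rewrite /gen_form /form_of -/(A p) -/(A q) -/(B p) -/(B q); ring.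
under eq_bigr do rewrite big_split -!mulr_sumr.
rewrite big_split -!mulr_suml /=.
have sumA : \sum_p 'X_p * A p = 'X_a2 - 'X_a1.
  by under eq_bigr do rewrite AE; apply: sumX.
by rewrite sumA sumX; ring.
Qed.

(* The primitives [g p] of the components of a lift can be chosen with sum    *)
(* zero; the family [g] is then a combination of differences of two points.   *)
Lemma specht_form_span h z : (h + 4 <= n)%N -> specht_form h z ->
  exists c : seq I -> I -> I -> R, forall p q l,
    z p q l = \sum_(a <- words I h.+2) \sum_b1 \sum_(b2 | uniq (a ++ [:: b1; b2]))
      c a b1 b2 * gen_form a b1 b2 p q l.
Proof.
rewrite addnC => hn zf; have [u [u_alt u_off u_th u_sum u_deg] zu] :=
  lift_of_form zf.
have n_gt1 : (1 < n)%N by apply: leq_trans hn.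
pose o0 : I := Ordinal (ltnW n_gt1).
pose o1 : I := Ordinal n_gt1.
(* The multiplier has to differ from [p], so that [t p] does not involve [p]. *)
pose t p := wedge (if p == o0 then o1 else o0) (u p).
have t_alt p : alternating (t p) by apply: alternating_wedge.
have t_off p : off (pred1 p) (t p).
  by apply: off_wedge (u_off p) => /=; case: (eqVneq p o0) => [->|];
    rewrite // eq_sym.
have t_deg p : degree_eq h.+2 (t p) by apply: degree_wedge.
have t_th p l : contract (fun=> 1) (t p) l = u p l.
  by rewrite contract_wedge mul1r wedge0 ?subr0.
have [||l|v [v_alt v_off v_deg v_th] vs] := @split_sum h.+2 (fun l => \sum_p t p
  l) hn.
- by move=> s a b l; rewrite -sumrN; apply: eq_bigr => p _; apply: t_alt.
- by move=> l sl; rewrite big1 // => p _; apply: t_deg.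
- rewrite contract1 exchange_big -[RHS](u_sum l); apply: eq_bigr => p _.
  by rewrite -t_th contract1.
pose g p l := t p l - v p l.
have g_alt p : alternating (g p) by move=> s a b l; rewrite /g t_alt v_alt opprD.
have g_off p : off (pred1 p) (g p).
  by move=> l pl; rewrite /g (t_off p) // (v_off p) // subrr.
have g_deg p : degree_eq h.+2 (g p).
  by move=> l sl; rewrite /g (t_deg p) // (v_deg p) // subrr.
have g_sum l : \sum_p g p l = 0 by rewrite sumrB vs subrr.
have g_th p l : contract (fun=> 1) (g p) l = u p l.
  by rewrite contractD contractN t_th v_th subr0.
have [k kE] : {k | (n - h.+2)%N = k.+1} by exists (n - h.+3)%N;
  rewrite subnSK // ltnW.
(* The factorial counts the orderings of [a], and [k.+1] the choices of [b1] outside [a]. Each such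
   [b1] gives the same sum over [b2], because $\sum_{b_2}g_{b_2}=0$. *)
pose c : K := (h.+2)`!%:R^-1 * k.+1%:R^-1.
exists (fun a b1 b2 => c *: g b2 a).
have uE p m : u p m = \sum_(a <- words I h.+2) \sum_b1
    \sum_(b2 | uniq (a ++ [:: b1; b2])) c *: g b2 a *
      (((p == b2)%:R - (p == b1)%:R) * contract (fun=> 1) (wedges a) m).
  rewrite -g_th; have [f fE] : {f | (h.+2)`! = f.+1} by exists (h.+2)`!.-1;
    rewrite prednK ?fact_gt0.
  have -> : contract (fun=> 1) (g p) m = c *: contract (fun=> 1)
      (fun l => \sum_(a <- words I h.+2) (g p a *+ k.+1) * wedges a l) m.
    rewrite -contractZ; apply: eq_contract => l sl.
    have [{}sl|{}sl] := eqVneq (size l) h.+2; last first.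
      rewrite g_deg // big_seq big1 ?scaler0 // => a /size_words sa.
      by rewrite (degree_wedges _ (m := a)) ?mulr0 // sa.
    under eq_bigr do rewrite mulrnAl.
    rewrite sumrMnl sum_wedges // -scaler_nat scalerA /c divfK ?natK_neq0 //.
    by rewrite -scaler_nat scalerA mulVf ?scale1r // fE natK_neq0.
  rewrite contract_sum scaler_sumr; apply: eq_big_seq => a /size_words sa.
  set A := contract _ _ m.
  under eq_bigr do under eq_bigr do rewrite mulrA.
  under eq_bigr do rewrite -mulr_suml; rewrite -mulr_suml scalerAl; congr (_ * _).
  under eq_bigr do under eq_bigr do rewrite -scalerAl.
  under eq_bigr do rewrite -scaler_sumr; rewrite -scaler_sumr; congr (_ *: _).
  have [ua|Na] := boolP (uniq a); last first.
    rewrite (alternating_uniq charK0 (g_alt p)) // mul0rn big1 // => b1 _.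
    by rewrite big1 // => b2; rewrite cat_uniq (negPf Na).
  transitivity (\sum_(b1 | b1 \notin a) \sum_b2 g b2 a * ((p == b2)%:R - (p ==
    b1)%:R)).
    under eq_bigr do under eq_bigr do rewrite mulrBr.
    under eq_bigr do rewrite sumrB -mulr_suml g_sum mul0r subr0.
    rewrite -kE -sa -card_notin // -sumr_const; apply: eq_bigr => b1 _.
    rewrite (bigD1 p) //= eqxx mulr1 big1 ?addr0 // => b2 /negPf.
    by rewrite eq_sym => ->; rewrite mulr0.
  rewrite big_mkcond; apply: eq_bigr => b1 _.
  have [b1a|b1a] /= := boolP (b1 \in a).
    by rewrite big1 // => b2; rewrite cat_uniq /= b1a /= andbF.
  rewrite [RHS]big_mkcond; apply: eq_bigr => b2 _;
    rewrite cat_uniq /= ua (negPf b1a) orbF inE andbT /=.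
  have [b2a|b2a] /= := boolP (b2 \in a).
    by rewrite (g_off b2) ?mul0r // has_pred1.
  by have [->|_] := eqVneq b1 b2; rewrite ?subrr ?mulr0.
move=> p q l; rewrite zu /form_of !uE -big_split; apply: eq_bigr => a _.
rewrite -big_split; apply: eq_bigr => b1 _; rewrite -big_split;
  apply: eq_bigr => b2 _.
by rewrite /= -mulrDr.
Qed.

End SpechtForms.

Arguments gen_form {K n}.
Arguments top_form {K n}.

(** * The top form and the last differential *)

Section TopForm.
Variables (K : fieldType) (charK0 : [pchar K] =i pred0) (n : nat).
Notation R := {mpoly K[n]}.
Notation I := 'I_n.
Notation X := (fun a : I => 'X_a : R).
Local Notation Vol := (volume : seq I -> R).

(** Swap, then delete [k] before [j]: as [j < k], the position of [j] is unaffected. The swap gives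
    the extra sign. *)
Lemma volume_cons2 (j k : I) m : (j < k)%N ->
  Vol [:: j, k & m] = (-1) ^+ (j + k + 1) *
    wedges [seq x <- enum I | x \notin [:: j; k]] m.
Proof.
move=> jk; rewrite (alternating2 _ _ _ (@alternating_volume _ _ _)) /volume.
have jE : j \in rem k (enum I).
  by rewrite (rem_filter _ (enum_uniq _)) mem_filter mem_enum /= neq_ltn jk.
rewrite !wedges_cons ?rem_uniq ?enum_uniq ?mem_enum // index_enum_ord.
have -> : index j (rem k (enum I)) = j.
  rewrite remE index_enum_ord index_cat.
  have jt : j \in take k (enum I).
    by rewrite in_take ?mem_enum // index_enum_ord.
  rewrite jt -[RHS]index_enum_ord -[in RHS](cat_take_drop k (enum I)).
  by rewrite index_cat jt.
have ue := enum_uniq I.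
rewrite mulrA -exprD (rem_filter _ ue) (rem_filter _ (filter_uniq _ ue)).
rewrite addnC addn1 exprS mulN1r mulNr addnC -(filter_predI _ _ (enum I)).
congr (- (_ * wedges _ _)); apply: eq_filter => x.
by rewrite /= !inE negb_or.
Qed.

Lemma sum_sym (F : I -> I -> R) : (forall j k, F j k = F k j) ->
  (forall j, F j j = 0) ->
  \sum_j \sum_k F j k = (\sum_(j < n) \sum_(k < n | (j < k)%N) F j k) *+ 2.
Proof.
move=> Fsym F0.
transitivity (\sum_(j < n) (\sum_(k < n | (j < k)%N) F j k + \sum_(k < n | (k <
  j)%N) F j k)).
  apply: eq_bigr => j _; rewrite (bigID (fun k : I => j < k)%N) /=; congr (_ + _).
  rewrite (bigD1 j) ?ltnn //= F0 add0r; apply: eq_bigl => k.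
  by rewrite -leqNgt ltn_neqAle andbC.
rewrite big_split mulr2n /=; congr (_ + _).
rewrite (exchange_big_dep predT) //=; apply: eq_bigr => k _.
by apply: eq_bigr => j _; apply: Fsym.
Qed.

(** The summand is symmetric in [j], [k], so twice the sum runs over all pairs; there the indicators
    collapse one index and leave the double contraction of the volume element. *)
Lemma top_form_gen p q l :
  \sum_(j < n) \sum_(k < n | (j < k)%N) (-1) ^+ (j + k + 1) * ('X_j * 'X_k : R) *
    gen_form [seq x <- enum I | x \notin [:: j; k]] j k p q l = top_form p q l :> R.
Proof.
have O_alt : alternating Vol := @alternating_volume _ _ n.
have c_alt := alternating_contract (fun=> 1) O_alt.
have d_alt := alternating_contract X c_alt.
pose V j k m := contract (fun=> 1) (fun s => Vol [:: j, k & s]) m.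
have VC j k m : V j k m = - V k j m.
  by rewrite -contractN; apply: eq_contract => s _;
    apply: (alternating2 _ _ _ O_alt).
pose B (p j k : I) : R := (p == k)%:R - (p == j)%:R.
pose F j k := 'X_j * 'X_k * (B p j k * V j k (q :: l) + B q j k * V j k (p :: l)).
transitivity (\sum_(j < n) \sum_(k < n | (j < k)%N) F j k).
  apply: eq_bigr => j _; apply: eq_bigr => k jk; rewrite /F /gen_form /form_of.
  rewrite -/(B p j k) -/(B q j k).
  have VE m : V j k m = (-1) ^+ (j + k + 1) * contract (fun=> 1) (wedges
      [seq x <- enum I | x \notin [:: j; k]]) m.
    by rewrite -contractM; apply: eq_contract => s _; apply: volume_cons2.
  by rewrite !VE; ring.
have BC r j k : B r j k = - B r k j by rewrite opprB.
have FE : (\sum_(j < n) \sum_(k < n | (j < k)%N) F j k) *+ 2 = \sum_j \sum_k F j k.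
  rewrite sum_sym // => [j k|j].
    by rewrite /F VC [V j k _ in X in _ + X]VC !(BC _ j k); ring.
  by rewrite /F /B !subrr !mul0r addr0 mulr0.
pose S r m := \sum_j \sum_k 'X_j * 'X_k * (B r j k * V j k m).
have SE r m : S r m = ('X_r * contract X (contract (fun=> 1) Vol) (r :: m)) *+ 2.
  pose S1 := \sum_j \sum_k 'X_j * 'X_k * ((r == k)%:R * V j k m).
  have -> : S r m = S1 *+ 2.
    rewrite mulr2n {2}/S1 exchange_big -big_split; apply: eq_bigr => j _.
    rewrite -big_split; apply: eq_bigr => k _ /=.
    by rewrite (VC k j) /B; ring.
  congr (_ *+ 2); rewrite mulr_sumr; apply: eq_bigr => j _.
  rewrite (bigD1 r) //= eqxx mul1r big1 ?addr0 => [|k /negPf]; last first.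
    by rewrite eq_sym => ->; rewrite mul0r mulr0.
  have -> : V j r m = contract (fun=> 1) Vol [:: j, r & m]; last by ring.
  apply: eq_bigr => a _; congr (_ * _).
  rewrite (alternating2 a j _ O_alt) (alternating_cons j O_alt [::] a r m).
  by rewrite opprK.
have {}FE : (\sum_(j < n) \sum_(k < n | (j < k)%N) F j k) *+ 2 = S p (q :: l) + S
  q (p :: l).
  rewrite FE -big_split; apply: eq_bigr => j _; rewrite -big_split.
  by apply: eq_bigr => k _; rewrite /F mulrDr.
rewrite (natKV charK0 FE); apply/esym/(natKV charK0).
rewrite !SE (alternating2 q p _ d_alt) -mulrnDl /top_form.
by congr (_ *+ 2); ring.
Qed.

(** When [[:: p, q & l]] lacks only the first two letters [x], [j] of the enumeration, the double
    contraction is $x_j-x_x$. *)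
Lemma top_form_neq0 : (4 <= n)%N -> exists p q l, size l = (n - 4)%N /\ top_form
  p q l != 0 :> R.
Proof.
move=> n4; have := size_enum_ord n; have := enum_uniq I.
case E: (enum I) => [|x [|j [|p [|q l]]]] ul sl; try by rewrite -sl in n4.
exists p, q, l; split; first by move/(congr1 (subn^~ 4)): sl => /= <-;
  rewrite !subSS subn0.
have xj : x != j by move: ul; rewrite /= inE negb_or -!andbA => /andP[].
pose m := [:: p, q & l].
have memP a b : Vol [:: b, a & m] != 0 -> b \in [:: x; j] /\ a \in [:: x; j].
  move/wedges_perm; rewrite E => pe.
  have ab : perm_eq [:: x; j] [:: b; a] by rewrite -(perm_cat2r m).
  by rewrite !(perm_mem ab) !inE !eqxx orbT.
have Vol0 a b : b \notin [:: x; j] -> Vol [:: b, a & m] = 0.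
  by apply: contraNeq => /memP[].
have Volj a b : a \notin [:: x; j] -> Vol [:: b, a & m] = 0.
  by apply: contraNeq => /memP[].
have O_alt : alternating Vol := @alternating_volume _ _ n.
have Vol1 : Vol [:: x, j & m] = 1 by rewrite /volume E wedges_id.
have th a b : perm_eq [:: x; j] [:: b;
  a] -> contract (fun=> 1) Vol (a :: m) = Vol [:: b, a & m].
  move=> pe; rewrite contract1 (bigD1 b) //= big1 ?addr0 // => c cb.
  have [ca|ca] := eqVneq c a.
    by rewrite ca (alternating_mem charK0 O_alt) ?mem_head.
  by apply: Vol0; rewrite (perm_mem pe) !inE negb_or cb.
rewrite /top_form -/m (_ : contract X _ m = 'X_j - 'X_x); last first.
  transitivity (\sum_a 'X_a * contract (fun=> 1) Vol (a :: m)) => //.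
  rewrite (bigD1 j) // (bigD1 x) //= big1 ?addr0 => [|a /andP[aj ax]].
    rewrite (th j x) // Vol1 (th x j); last by rewrite -[[:: j; x]]/(rot 1 [:: x;
      j]) perm_sym perm_rot.
    by rewrite (alternating2 _ _ _ O_alt) Vol1 mulr1 mulrN1.
  rewrite contract1 big1 ?mulr0 // => b _; apply: Volj.
  by rewrite !inE negb_or aj ax.
have X_neq a b : a != b -> 'X_a - 'X_b != 0 :> R.
  move=> ab; apply: contraNneq ab => /(congr1 (mcoeff U_(a))).
  rewrite mcoeffB !mcoeffXU mcoeff0 eqxx eq_sym; case: eqP => // _ /eqP.
  by rewrite subr0 oner_eq0.
rewrite mulf_neq0 ?X_neq //; last by rewrite eq_sym.
by move: ul; rewrite /= !inE !negb_or -!andbA => /and5P[_ _ _ _ /and5P[_ _ ]].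
Qed.

End TopForm.

(** * Coordinates of a tensor product *)

Section Tensor.
Variables (K : fieldType) (n : nat).
Notation R := {mpoly K[n]}.
Implicit Types (U : {vspace tabloid_space K n}) (t : tabloid n) (r : R).

Lemma span_ind (V : vectType K) (P : V -> Prop) (X : seq V) :
  P 0 -> (forall c x v, x \in X -> P v -> P (c *: x + v)) ->
  forall v, v \in <<X>>%VS -> P v.
Proof.
move=> P0 PD v /(coord_span (X := in_tuple X)) ->.
elim/big_rec: _ => // i w _; apply: PD.
exact: mem_nth.
Qed.

Lemma tensD U v w r : tens U (v + w) r = tens U v r + tens U w r.
Proof. by apply/rowP => j; rewrite !mxE linearD scalerDl. Qed.

Lemma tensZ U c v r : tens U (c *: v) r = c%:MP *: tens U v r.
Proof.
by apply/rowP => j; rewrite !mxE linearZ /= -scalerA mul_mpolyC.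
Qed.

Lemma tens0 U r : tens U 0 r = 0.
Proof. by apply/rowP => j; rewrite !mxE linear0 scale0r. Qed.

Lemma tensr U v r : tens U v r = r *: tens U v 1.
Proof. by apply/rowP => j; rewrite !mxE -scalerAr mulr1. Qed.

Lemma tensor_basis U (u : tensor U) : u = \sum_j u 0 j *: tens U (vbasis U)`_j 1.
Proof.
rewrite [LHS]row_sum_delta; apply: eq_bigr => j _; congr (_ *: _).
apply/rowP => k; rewrite !mxE eqxx /= coord_free ?(basis_free (vbasisP U)) //.
by rewrite eq_sym; case: eqP; rewrite ?scale1r ?scale0r.
Qed.

Lemma vbasis_nth_mem U (j : 'I_(\dim U)) : (vbasis U)`_j \in U.
Proof. by rewrite vbasis_mem // mem_nth ?size_tuple. Qed.

Lemma tensor_ind U X (P : tensor U -> Prop) : U = <<X>>%VS ->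
  P 0 -> (forall u v, P u -> P v -> P (u + v)) ->
  (forall r x, x \in X -> P (r *: tens U x 1)) -> forall u, P u.
Proof.
move=> UX P0 PD PX u; rewrite [u]tensor_basis.
apply: big_rec => // j w _ Pw; apply: (PD) => //.
have vX : {subset U <= <<X>>%VS} by move=> v; rewrite -UX.
have := vX _ (vbasis_nth_mem j); move: _`_j (u 0 j) => v r vXX.
move: v vXX r; apply: (@span_ind _ (fun v => forall r, P (r *: tens U v 1))) =>
  [r|c x v xX Pv r].
  by rewrite tens0 scaler0.
by rewrite tensD tensZ scalerDr scalerA; apply: PD; [apply: PX|apply: Pv].
Qed.

Definition tensor_eval U t (u : tensor U) : R^o :=
  \sum_(j < \dim U) (((vbasis U)`_j : tabloid_space K n) t : K) *: u 0 j.

Lemma tensor_eval_linear U t : linear (@tensor_eval U t).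
Proof.
move=> c u v; rewrite /tensor_eval scaler_sumr -big_split; apply: eq_bigr => j _ /=.
by rewrite !mxE scalerDr scalerAr.
Qed.

HB.instance Definition _ U t :=
  GRing.isLinear.Build R (tensor U) R^o _ (@tensor_eval U t) (@tensor_eval_linear
    U t).

Lemma tensor_eval_tens U v r t :
  v \in U -> tensor_eval t (tens U v r) = (v t : K) *: r.
Proof.
move=> vU; rewrite [in RHS](coord_vbasis vU) sum_ffunE scaler_suml.
apply: eq_bigr => j _; rewrite mxE scalerA ffunE.
by rewrite mulrC.
Qed.

(** Monomial by monomial, this is the freeness of the basis of [U] among functions on tabloids. *)
Lemma tensor_eval_inj U (u : tensor U) : (forall t, tensor_eval t u = 0) -> u = 0.
Proof.
move=> u0; apply/rowP => j; rewrite mxE; apply/mpolyP => m; rewrite mcoeff0.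
have /freeP/(_ (fun j => (u 0 j)@_m)) := basis_free (vbasisP U); apply.
apply/ffunP => t; rewrite sum_ffunE ffunE.
have /(congr1 (mcoeff m)) := u0 t; rewrite raddf_sum mcoeff0 => E.
rewrite -[RHS]E; apply: eq_bigr => k _.
by rewrite ffunE /= mcoeffZ mulrC.
Qed.

Definition rowlin_fun (W : lmodType R) m (w : 'I_m -> W) (u : 'rV[R]_m) : W :=
  \sum_k u 0 k *: w k.

Lemma rowlin_linear (W : lmodType R) m (w : 'I_m -> W) : linear (rowlin_fun w).
Proof.
move=> c u v; rewrite /rowlin_fun scaler_sumr -big_split; apply: eq_bigr => k _ /=.
by rewrite !mxE scalerDl scalerA.
Qed.

HB.instance Definition _ (W : lmodType R) m (w : 'I_m -> W) :=
  GRing.isLinear.Build R _ W _ (rowlin_fun w) (rowlin_linear w).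

Definition rowlin (W : lmodType R) m (w : 'I_m -> W) : {linear 'rV[R]_m -> W} :=
  rowlin_fun w.

End Tensor.

(** * Polytabloids of near-hook shape *)

Section Tableaux.
Variable n : nat.
Notation I := 'I_n.
Implicit Types (x y z w p q : I) (s t a b c l : seq I).

Definition singles s : seq (seq I) := [seq [:: x] | x <- s].

(** Given by rows; the columns are [[:: x, z & t]], [[:: y; w]] and the singletons of [s], so
    transposition exchanges [y] with [z] and [s] with [t]. *)
Definition near_hook x y s z w t : seq (seq I) :=
  [:: [:: x, y & s], [:: z; w] & singles t].

Lemma singles_inj : injective singles.
Proof. by apply: inj_map => x y []. Qed.

Lemma flatten_singles s : flatten (singles s) = s.
Proof. by elim: s => //= x s ->. Qed.

Lemma shape_singles s : shape (singles s) = nseq (size s) 1%N.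
Proof. by elim: s => //= x s ->. Qed.

Lemma pmap_singles_some (f : seq I -> option I) s :
  (forall x, f [:: x] = Some x) -> pmap f (singles s) = s.
Proof. by move=> f1; elim: s => //= x s IH; rewrite f1 /= IH. Qed.

Lemma pmap_singles_none (f : seq I -> option I) s :
  (forall x, f [:: x] = None) -> pmap f (singles s) = [::].
Proof. by move=> f1; elim: s => //= x s IH; rewrite f1 /= IH. Qed.

Lemma map_onth_singles s :
  [seq seq_of_opt (onth s j) | j <- iota 0 (size s)] = singles s.
Proof.
elim: s => //= x s IH; rewrite -[1%N]addn0 iotaDl -map_comp; congr (_ :: _).
by rewrite -IH; apply: eq_map => j.
Qed.

Lemma transpose_near_hook x y s z w t :
  transpose (near_hook x y s z w t) = near_hook x z t y w s.
Proof.
rewrite /transpose /near_hook /= pmap_singles_some // pmap_singles_none //.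
congr [:: _, _ & _]; rewrite -[2%N]addn0 iotaDl -map_comp -[RHS]map_onth_singles.
apply: eq_map => j; rewrite /= ?add2n pmap_singles_none //=.
by case: (onth s j) => [v|]; rewrite /= onth0n.
Qed.

Lemma tableau2E x y s z w t : tableau2 [:: x, z & t] [:: y;
  w] s = near_hook x y s z w t.
Proof. exact: transpose_near_hook. Qed.

Lemma transpose_singles x s : transpose (singles (x :: s)) = [:: x :: s].
Proof. by rewrite /transpose /= pmap_singles_some. Qed.

Lemma transpose_column x s : transpose [:: x :: s] = singles (x :: s).
Proof.
by rewrite -map_onth_singles /transpose; apply: eq_map => j /=; case: (onth _ j).
Qed.

Definition near_hook_shape h : seq nat := [:: n - h.+2, 2 & nseq h 1]%N.

Lemma sumn_near_hook_shape h : (h + 4 <= n)%N -> sumn (near_hook_shape h) = n.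
Proof. by move=> hn; rewrite /= sumn_nseq mul1n; lia. Qed.

Lemma Tab_near_hook h x y s z w t : (h + 4 <= n)%N -> size t = h ->
  perm_eq ([:: x, z & t] ++ [:: y; w] ++ s) (enum I) ->
  near_hook x y s z w t \in Tab n (near_hook_shape h).
Proof.
move=> hn th pe; rewrite mem_Tab ?sumn_near_hook_shape //; apply/andP; split.
  have := perm_size pe; rewrite !size_cat /= size_enum_ord th => sn.
  rewrite /shape /= -/(shape _) shape_singles th /near_hook_shape.
  by apply/eqP; congr [:: _, _ & _]; lia.
rewrite /= flatten_singles; apply: perm_trans pe.
by apply/seq.permP => P; rewrite /= !count_cat /=; lia.
Qed.

Lemma shape_nseq1 k (T : seq (seq I)) : shape T = nseq k 1%N -> exists s, T =
  singles s.
Proof.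
elim: T k => [|r T IH] [|k] //=; first by exists [::].
by case: r => [|v [|]] // [/IH[s ->]]; exists (v :: s).
Qed.

Lemma Tab_near_hookP h T : (h + 4 <= n)%N -> T \in Tab n (near_hook_shape h) ->
  exists x y s z w t, [/\ T = near_hook x y s z w t, size t = h &
    perm_eq ([:: x, z & t] ++ [:: y; w] ++ s) (enum I)].
Proof.
move=> hn; rewrite mem_Tab ?sumn_near_hook_shape // => /andP[/eqP].
case: T => [|[|x [|y s]] [|r T]] //=; try by case; lia.
case: r => [|z [|w [|? ?]]] // [_ sT] pe.
have [t TE] := shape_nseq1 sT.
exists x, y, s, z, w, t; rewrite TE; split=> //.
  by move: sT; rewrite TE shape_singles => /(congr1 size); rewrite !size_nseq.
move: pe; rewrite TE /= flatten_singles; apply: perm_trans.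
by apply/seq.permP => P; rewrite /= !count_cat /=; lia.
Qed.

Definition row_tabloid p q l : tabloid n :=
  tabloid_of [:: [seq x <- enum I | x \notin [:: p, q & l]], [:: p; q] & singles l].

Lemma eq_tabloid_of T T' : (forall i, nth [::] T i =i nth [::] T' i) ->
  tabloid_of T = tabloid_of T' :> tabloid n.
Proof.
by move=> TT; apply/ffunP => i; rewrite !ffunE; apply/setP => x; rewrite !inE TT.
Qed.

Lemma tabloid_of_near_hook x y s z w t :
  perm_eq ([:: x, z & t] ++ [:: y; w] ++ s) (enum I) ->
  tabloid_of (near_hook x y s z w t) = row_tabloid z w t.
Proof.
move=> pe; apply: eq_tabloid_of => -[|i] //= v; rewrite mem_filter mem_enum andbT.
have pe' : perm_eq ([:: x, y & s] ++ [:: z, w & t]) (enum I).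
  by apply: perm_trans pe; apply/seq.permP => P; rewrite /= !count_cat /=; lia.
have uT : uniq ([:: x, y & s] ++ [:: z, w & t]) by rewrite (perm_uniq pe')
  enum_uniq.
have vT : v \in [:: x, y & s] ++ [:: z, w & t] by rewrite (perm_mem pe') mem_enum.
move: vT uT; rewrite mem_cat cat_uniq => /orP[vA|vB] /and3P[_ /hasPn AB _].
  by rewrite vA; apply/esym/negP => /AB; rewrite /= vA.
by rewrite vB; apply/negbTE/AB.
Qed.

(** A tabloid records [n] rows, and the bound ensures that every letter of [l] is recorded. *)
Lemma row_tabloid_inj p q l p' q' l' : (size l + 2 <= n)%N -> size l = size l' ->
  row_tabloid p q l = row_tabloid p' q' l' -> [:: p; q] =i [:: p'; q'] /\ l = l'.
Proof.
move=> ln ll' /ffunP E.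
have n1 : (1 < n)%N by lia.
split=> [x|].
  by have := E (Ordinal n1); rewrite !ffunE => /setP/(_ x); rewrite !inE.
apply: (@eq_from_nth _ p) => // i il.
have i2 : (i.+2 < n)%N by lia.
have := E (Ordinal i2); rewrite !ffunE /= (nth_map p) // (nth_map p) -?ll' //.
by move/setP/(_ (nth p l i)); rewrite !inE eqxx => /esym/eqP.
Qed.

Lemma perm_eq_rest s : uniq s ->
  perm_eq (s ++ [seq v <- enum I | v \notin s]) (enum I).
Proof.
move=> us; have ue := enum_uniq I; apply: uniq_perm => //.
  rewrite cat_uniq us (filter_uniq _ ue) andbT.
  by apply/hasPn => v; rewrite mem_filter => /andP[].
by move=> v; rewrite mem_cat mem_filter mem_enum andbT orbN.
Qed.

End Tableaux.

(** * Evaluation of polytabloids at tabloids *)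

Section Polytabloid.
Variables (K : fieldType) (charK0 : [pchar K] =i pred0) (n : nat).
Notation R := {mpoly K[n]}.
Notation I := 'I_n.
Implicit Types (x y z w p q : I) (s t a b c l : seq I) (g : 'S_n).

Lemma polytabloidE (T : seq (seq I)) (u : tabloid n) :
  (polytabloid K T u : K) =
  \sum_(g in column_stab T) (-1) ^+ odd_perm g * (u == tabloid_of (act_tableau g
    T))%:R.
Proof. by rewrite /polytabloid sum_ffunE; apply: eq_bigr => g _;
  rewrite !ffunE. Qed.

Lemma act_near_hook g x y s z w t : act_tableau g (near_hook x y s z w t) =
  near_hook (g x) (g y) (map g s) (g z) (g w) (map g t).
Proof.
rewrite /act_tableau /near_hook /=; congr [:: _, _ & _].
by rewrite /singles -!map_comp.
Qed.

Lemma row_tabloidC p q l : row_tabloid p q l = row_tabloid q p l.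
Proof.
apply: eq_tabloid_of => -[|[|i]] v //=; last by rewrite !inE orbC.
by rewrite !mem_filter !inE orbCA.
Qed.

Section Eval.
Variables (x y : I) (s : seq I) (z w : I) (t : seq I).
Hypothesis sz : (size t + 4 <= n)%N.
Hypothesis pe : perm_eq ([:: x, z & t] ++ [:: y; w] ++ s) (enum I).
Let a := [:: x, z & t].
Let T := near_hook x y s z w t.

Let mem_a v : (v \in a) = [|| v == x, v == z | v \in t].
Proof. by rewrite !in_cons. Qed.

Let u_abs : uniq (a ++ [:: y; w] ++ s).
Proof. by rewrite (perm_uniq pe) enum_uniq. Qed.

Let mem_abs v : v \in a ++ [:: y; w] ++ s.
Proof. by rewrite (perm_mem pe) mem_enum. Qed.

Let tabloid_act g : tabloid_of (act_tableau g T) = row_tabloid (g z) (g w) (map g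
  t).
Proof.
rewrite act_near_hook; apply: tabloid_of_near_hook.
rewrite -[X in perm_eq X](_ : map g (a ++ [:: y; w] ++ s) = _);
  last by rewrite !map_cat.
apply: uniq_perm; rewrite ?enum_uniq ?map_inj_uniq //; first exact: perm_inj.
by move=> v; rewrite mem_enum -[v](permKV g) map_f.
Qed.

Let stabP g : reflect
  [/\ {subset map g a <= a}, {subset [:: g y; g w] <= [:: y; w]} & map g s = s]
  (g \in column_stab T).
Proof.
rewrite inE /columns transpose_near_hook /near_hook [all _ _]/= -/(all _).
apply: (iffP and3P) => [[/and3P[gx gz /allP gt] gb /allP gs]|[ga gb gs]]; split.
- by move=> v /mapP[v' + ->]; rewrite [v' \in a]mem_a => /or3P[/eqP->|/eqP->|/gt].
- by move: gb => /and3P[gy gw _] v; rewrite in_cons mem_seq1 => /orP[]/eqP->.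
- apply: map_id_in => v vs; have := gs [:: v]; rewrite map_f // => /(_ isT) /=.
  by rewrite andbT inE => /eqP.
- apply/and3P; split; try by apply: ga; rewrite map_f // mem_a eqxx ?orbT.
  by apply/allP => v vt; apply: ga; rewrite map_f // mem_a vt !orbT.
- by rewrite /= andbT !gb // !inE eqxx ?orbT.
apply/allP => r /mapP[v vs ->] /=; rewrite andbT inE.
have vi : (index v s < size s)%N by rewrite index_mem.
by rewrite -{1}(nth_index v vs) -(nth_map v v g) // gs nth_index.
Qed.

Let ya : y \notin a.
Proof. by move: u_abs; rewrite cat_uniq => /and3P[_ + _] => /hasPn/(_ y); apply;
  rewrite mem_head. Qed.

Let wa : w \notin a.
Proof. by move: u_abs; rewrite cat_uniq => /and3P[_ + _] => /hasPn/(_ w); apply;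
  rewrite !inE eqxx orbT. Qed.

Let yw : y != w.
Proof. by move: u_abs; rewrite cat_uniq => /and3P[_ _];
  rewrite /= inE negb_or -andbA => /and3P[]. Qed.

(** The signature is the value of the wedge of all letters at their images, which factors over the
    columns. *)
Let sign_stab g : g \in column_stab T ->
  (-1) ^+ odd_perm g = wedges a (map g a) * wedges [:: y; w] [:: g y; g w] :> R.
Proof.
case/stabP => ga gb gs.
have := alternating_perm g (alternating_wedges R (a ++ [:: y;
  w] ++ s)) u_abs mem_abs.
rewrite wedges_id // mulr1 => <-; rewrite 2!map_cat gs.
have ub := u_abs; rewrite cat_uniq in ub; case/and3P: ub => ua /hasPn ab ub.
rewrite cat_uniq in ub; case/and3P: ub => ub /hasPn bs us.
rewrite wedges_cat; last 2 first.
- by apply/hasPn => v /ga va; apply/negP => /ab; rewrite /= va.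
- apply/hasPn => v va; apply/negP => vb.
  have /ab : v \in [:: y; w] ++ s; last by rewrite /= va.
  have {vb} : v \in [:: g y; g w] ++ s by [].
  by rewrite 2!mem_cat => /orP[/gb ->|->]; rewrite ?orbT.
rewrite wedges_cat ?wedges_id ?mulr1 //.
- by apply/hasPn => v /gb vb; apply/negP => /bs; rewrite /= vb.
by apply/hasPn => v vb; apply/negP => /bs; rewrite /= vb.
Qed.

Let contract_a v m : wedges a (v :: m) != 0 :> R -> forall v', v' != v ->
  wedges a (v' :: m) = 0 :> R.
Proof.
move=> /wedges_perm p1 v' v'v; apply: contraNeq v'v => /wedges_perm p2.
have pvv : perm_eq [:: v'] [:: v].
  by rewrite -(perm_cat2r m); apply: perm_trans p1; rewrite perm_sym.
by have := perm_mem pvv v'; rewrite !inE eqxx => /esym.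
Qed.

Let sub_gen g : g \in column_stab T ->
  gen_form a y w (g z) (g w) (map g t) = (-1) ^+ odd_perm g :> R.
Proof.
move=> gT; have [ga gb gs] := stabP _ gT; rewrite sign_stab //.
have gza : g z \in a by apply: ga; rewrite map_f // mem_a eqxx orbT.
have B0 : (g z == w) = false /\ (g z == y) = false.
  by split; apply: contraTF gza => /eqP->.
rewrite /gen_form /form_of B0.1 B0.2 subrr mul0r add0r mulrC; congr (_ * _).
  have nz : wedges a (g x :: g z :: map g t) != 0 :> R.
    have := sign_stab gT; rewrite /= => E; apply/eqP => E0; move: E.
    by rewrite E0 mul0r => /eqP; rewrite signr_eq0.
  rewrite contract1 (bigD1 (g x)) //= big1 ?addr0 // => v.
  exact: (contract_a nz).
have gwb : g w \in [:: y; w] by apply: gb; rewrite !inE eqxx orbT.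
have gyb : g y \in [:: y; w] by apply: gb; rewrite !inE eqxx.
have gyw : g y != g w by rewrite (inj_eq perm_inj).
move: gwb gyb gyw; rewrite !inE => /orP[]/eqP-> /orP[]/eqP->; rewrite ?eqxx // => _.
- rewrite (negPf yw) sub0r (alternating2 _ _ _ (alternating_wedges _ _)).
  by rewrite wedges_id //= inE yw.
- by rewrite eq_sym (negPf yw) subr0 wedges_id //= inE yw.
Qed.

(** At most one column permutation carries [T] to a given tabloid, so the coefficient is 0 or a
    sign. A nonzero term of [gen_form] produces this permutation, and then the two signs agree. *)
Lemma polytabloid_eval p q l : size l = size t ->
  ((polytabloid K T (row_tabloid p q l) : K)%:MP : R) = gen_form a y w p q l.
Proof.
move=> lt; rewrite polytabloidE.
pose P p q g := (g \in column_stab T) && (row_tabloid p q l == row_tabloid (g z)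
  (g w) (map g t)).
have genC p' q' : gen_form a y w p' q' l = gen_form a y w q' p' l :> R.
  by rewrite /gen_form /form_of addrC.
have exP p' q' : ((q' == w)%:R - (q' == y)%:R) *
    contract (fun=> 1) (wedges a) (p' :: l) != 0 :> R -> exists g, P p' q' g.
  rewrite mulf_eq0 negb_or contract1 => /andP[qb al].
  have [v /wedges_perm pa] : exists v, wedges a (v :: p' :: l) != 0 :> R.
    apply/existsP; apply: contraNT al; rewrite negb_exists => /forallP a0.
    by rewrite big1 // => v _; apply/eqP; rewrite -[_ == _]negbK.
  have [y' pb] : exists y', perm_eq [:: y; w] [:: y'; q'].
    have [->|q'w] := eqVneq q' w; first by exists y.
    have [->|q'y] := eqVneq q' y; first by exists w; rewrite -(perm_rot 1).
    by move: qb; rewrite (negPf q'w) (negPf q'y) subrr eqxx.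
  have pm : perm_eq ((v :: p' :: l) ++ [:: y'; q'] ++ s) (enum I).
    by apply: perm_trans pe; rewrite perm_sym !perm_cat.
  have [g] := perm_eq_enum_perm pe pm.
  rewrite !map_cat => /eqP; rewrite eqseq_cat; last by rewrite /= size_map lt.
  case/andP=> /eqP ga; rewrite eqseq_cat // => /andP[/eqP gb /eqP gs].
  exists g; apply/andP; split.
    apply/stabP; split => // v'; first by rewrite ga (perm_mem pa).
    by rewrite (perm_mem pb) -gb.
  by case: ga gb => _ -> -> [_ ->].
have PC p' q' g : P p' q' g = P q' p' g by rewrite /P row_tabloidC.
have [g Pg|P0] := pickP (P p q); last first.
  rewrite big1 => [|g gT]; last first.
    by have := P0 g; rewrite /P gT /= tabloid_act => ->; rewrite mulr0.
  rewrite mpolyC0; apply/esym/eqP; rewrite -[_ == _]negbK; apply/negP => gn.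
  have [E|/exP[g]] := eqVneq (((p == w)%:R - (p == y)%:R) *
    contract (fun=> 1) (wedges a) (q :: l) : R) 0; last by rewrite PC P0.
  by move: gn; rewrite /gen_form /form_of E add0r => /exP[g]; rewrite P0.
have /andP[gT /eqP gE] := Pg.
have [ga gb gs] := stabP _ gT.
have sz2 (m : seq I) : size m = size t -> (size m + 2 <= n)%N by move=> ->; lia.
have gab g1 g2 : g1 \in column_stab T -> g2 \in column_stab T -> g1 z != g2 w.
  move=> /stabP[ga1 _ _] /stabP[_ gb2 _].
  have : g1 z \in a by apply: ga1; rewrite map_f // mem_a eqxx orbT.
  have : g2 w \in [:: y; w] by apply: gb2; rewrite !inE eqxx orbT.
  by rewrite !inE => /orP[]/eqP->; apply: contraTneq => ->.
have wN0 g' : g' \in column_stab T -> wedges a (map g' a) != 0 :> R.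
  move=> g'T; have E := sign_stab g'T; apply/eqP => E0; move: E.
  by rewrite E0 mul0r => /eqP; rewrite signr_eq0.
have rowP g' : g' \in column_stab T ->
    row_tabloid p q l = row_tabloid (g' z) (g' w) (map g' t) -> g' = g.
  move=> g'T; have [ga' gb' gs'] := stabP _ g'T.
  rewrite gE => /row_tabloid_inj[||mem_zw gt]; rewrite ?size_map //;
    first exact: sz2.
  (* The second row has one entry in each of the first two columns, so the set determines both
     images; [x] and [y] then go to the letter left over in their columns. *)
  have gz : g' z = g z.
    have := mem_zw (g' z); rewrite !inE eqxx /= (negPf (gab _ _ g'T gT)) orbF.
    by move/eqP.
  have gw : g' w = g w.
    have := mem_zw (g' w); rewrite !inE eqxx /= orbT eq_sym (negPf (gab _ _ gT
      g'T)).
    by move/eqP.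
  have gx : g' x = g x.
    apply/eqP; apply: contraT => g'gx.
    have := wN0 _ g'T; rewrite -[map g' a]/(g' x :: g' z :: map g' t) gz -gt.
    by rewrite (contract_a (v := g x) _ g'gx) ?eqxx //; apply: (wN0 g).
  have gy : g' y = g y.
    have yw' : y != w := yw.
    have := gb (g y); have := gb' (g' y); have := gb (g w).
    have : g' y != g w by rewrite -gw (inj_eq perm_inj).
    have : g y != g w by rewrite (inj_eq perm_inj).
    rewrite !inE !eqxx !orbT /= => n1 n2 /(_ isT) h1 /(_ isT) h2 /(_ isT) h3.
    by move: n1 n2; case/orP: h1 => /eqP->; case/orP: h2 => /eqP->;
      case/orP: h3 => /eqP->;
       rewrite ?eqxx.
  apply/permP => v; have := mem_abs v.
  rewrite mem_cat => /orP[|/=].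
    rewrite mem_a => /or3P[/eqP->|/eqP->|vt] //.
    by move/eq_in_map: gt => /(_ v vt).
  rewrite !in_cons => /or3P[/eqP->|/eqP->|vs] //.
  by have/eq_in_map/(_ v vs) := etrans gs' (esym gs).
rewrite (bigD1 g) //= tabloid_act -gE eqxx mulr1 big1 ?addr0 => [|g' /andP[g'T
  g'g]]; last first.
  rewrite tabloid_act; case: eqP => [/(rowP _ g'T) E|_]; last by rewrite mulr0.
  by rewrite E eqxx in g'g.
have [mem_pq lE] := row_tabloid_inj (sz2 _ lt) (etrans lt (esym (size_map g t))) gE.
have zw : g z != g w by apply: gab.
have -> : gen_form a y w p q l = gen_form a y w (g z) (g w) (map g t) :> R.
  rewrite lE; have := mem_pq (g w); have := mem_pq (g z); have := mem_pq p.
  rewrite !inE !eqxx orbT /= [_ == p]eq_sym [g z == q]eq_sym [g w == p]eq_sym [g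
    w == q]eq_sym.
  move/esym/orP => [/eqP->|/eqP->].
    by rewrite eq_sym (negPf zw) => _ /= /eqP->.
  by rewrite eq_sym (negPf zw) => /= /eqP-> _; rewrite -lE genC.
by rewrite sub_gen // rmorph_sign.
Qed.

End Eval.
End Polytabloid.

(** * Specht modules as modules of forms *)

Section FormClosure.
Variables (K : fieldType) (n : nat).
Notation R := {mpoly K[n]}.
Notation I := 'I_n.
Implicit Types (z : I -> I -> seq I -> R).

Lemma eq_specht_form h z z' : (forall p q l, z p q l = z' p q l) ->
  specht_form h z -> specht_form h z'.
Proof.
move=> zz [z_alt z_sym z_diag z_cyc z_sum z_deg]; split.
- by move=> p q s a b t; rewrite -!zz z_alt.
- by move=> p q l; rewrite -!zz.
- by move=> p l; rewrite -zz.
- by move=> p q r l; rewrite -!zz.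
- by move=> p l; under eq_bigr do rewrite -zz.
- by move=> p q l sl; rewrite -zz z_deg.
Qed.

Lemma specht_form0 h : specht_form h (fun _ _ _ => 0 : R).
Proof.
split=> // [p q s a b t|p q r l|p l]; first by rewrite oppr0.
  by rewrite !addr0.
by rewrite big1_eq.
Qed.

Lemma specht_formD h z z' : specht_form h z -> specht_form h z' ->
  specht_form h (fun p q l => z p q l + z' p q l).
Proof.
move=> [z_alt z_sym z_diag z_cyc z_sum z_deg] [y_alt y_sym y_diag y_cyc y_sum
  y_deg].
split.
- by move=> p q s a b t; rewrite z_alt y_alt opprD.
- by move=> p q l; rewrite z_sym y_sym.
- by move=> p l; rewrite z_diag y_diag addr0.
- move=> p q r l; rewrite -[RHS]addr0 -{1}(z_cyc p q r l) -(y_cyc p q r l); ring.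
- by move=> p l; rewrite big_split /= z_sum y_sum addr0.
- by move=> p q l sl; rewrite z_deg ?y_deg ?addr0.
Qed.

Lemma specht_formM h c z : specht_form h z -> specht_form h (fun p q l => c * z p
  q l).
Proof.
move=> [z_alt z_sym z_diag z_cyc z_sum z_deg]; split.
- by move=> p q s a b t; rewrite z_alt mulrN.
- by move=> p q l; rewrite z_sym.
- by move=> p l; rewrite z_diag mulr0.
- by move=> p q r l; rewrite -!mulrDr z_cyc mulr0.
- by move=> p l; rewrite -mulr_sumr z_sum mulr0.
- by move=> p q l sl; rewrite z_deg ?mulr0.
Qed.

End FormClosure.

Section TensorForm.
Variables (K : fieldType) (n : nat).
Notation R := {mpoly K[n]}.
Notation I := 'I_n.
Implicit Types (U : {vspace tabloid_space K n}).

(** The guard on the length of [l] matches [sf_deg]; [polytabloid_eval] covers the words of the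
    right length. *)
Definition tensor_form U h p q l (u : tensor U) : R^o :=
  if size l == h then tensor_eval (row_tabloid p q l) u else 0.

Lemma tensor_form_linear U h p q l : linear (@tensor_form U h p q l).
Proof.
move=> c u v; rewrite /tensor_form; case: ifP => _; first exact: linearP.
by rewrite scaler0 addr0.
Qed.

HB.instance Definition _ U h p q l :=
  GRing.isLinear.Build R (tensor U) R^o _ (@tensor_form U h p q l)
    (@tensor_form_linear U h p q l).

End TensorForm.

Section SpechtTensor.
Variables (K : fieldType) (charK0 : [pchar K] =i pred0) (n h : nat).
Hypothesis hn : (h + 4 <= n)%N.
Notation R := {mpoly K[n]}.
Notation I := 'I_n.
(** A variable with an equation, so that the results apply to [resolution_specht], which is defined
    by cases. *)
Variable U : {vspace tabloid_space K n}.
Hypothesis UE : U = specht_module K n (near_hook_shape n h).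
Implicit Types (x y z w p q : I) (s t l : seq I) (u : tensor U).

Lemma polytabloid_mem x y s z w t : size t = h ->
  perm_eq ([:: x, z & t] ++ [:: y; w] ++ s) (enum I) ->
  polytabloid K (near_hook x y s z w t) \in U.
Proof.
by move=> th pe; rewrite UE memv_span // map_f // Tab_near_hook.
Qed.

Lemma tensor_form_polytabloid x y s z w t r p q l : size t = h ->
  perm_eq ([:: x, z & t] ++ [:: y; w] ++ s) (enum I) ->
  tensor_form h p q l (tens U (polytabloid K (near_hook x y s z w t)) r) =
  r * gen_form [:: x, z & t] y w p q l.
Proof.
move=> th pe; have := perm_uniq pe; rewrite enum_uniq cat_uniq /= => /and3P[_ yw _].
have [ya wa] : y \notin [:: x, z & t] /\ w \notin [:: x, z & t].
  by split; apply: contra yw => ->; rewrite ?orbT.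
rewrite /tensor_form; case: eqVneq => [lh|lh]; last first.
  have sx : size [:: x, z & t] = h.+2 by rewrite /= th.
  by rewrite (sf_deg (specht_form_gen charK0 sx ya wa)) ?mulr0.
rewrite tensor_eval_tens ?polytabloid_mem // -mul_mpolyC mulrC.
by rewrite (polytabloid_eval K) ?th ?lh.
Qed.

Lemma tensor_ind_polytabloid (P : tensor U -> Prop) :
  P 0 -> (forall u v, P u -> P v -> P (u + v)) ->
  (forall r x y s z w t, size t = h ->
     perm_eq ([:: x, z & t] ++ [:: y; w] ++ s) (enum I) ->
     P (r *: tens U (polytabloid K (near_hook x y s z w t)) 1)) -> forall u, P u.
Proof.
move=> P0 PD PT; apply: (tensor_ind UE) => // r v /mapP[T /(Tab_near_hookP hn)].
by move=> [x [y [s [z [w [t [-> th pe]]]]]]] ->; apply: PT.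
Qed.

Lemma specht_form_tensor u : specht_form h (fun p q l => tensor_form h p q l u).
Proof.
elim/tensor_ind_polytabloid: u => [|u v uf vf|r x y s z w t th pe].
- by apply: eq_specht_form (specht_form0 K n h) => p q l; rewrite linear0.
- by apply: eq_specht_form (specht_formD uf vf) => p q l; rewrite linearD.
have := perm_uniq pe; rewrite enum_uniq cat_uniq /= => /and3P[_ yw _].
have [ya wa] : y \notin [:: x, z & t] /\ w \notin [:: x, z & t].
  by split; apply: contra yw => ->; rewrite ?orbT.
have sx : size [:: x, z & t] = h.+2 by rewrite /= th.
apply: eq_specht_form (specht_formM r (specht_form_gen charK0 sx ya wa)) => p q l.
by rewrite linearZ /= tensor_form_polytabloid // mul1r.
Qed.

(** Polytabloids of this shape vanish at every tabloid other than the [row_tabloid p q l] with [l]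
    of length [h]. *)
Lemma tensor_form_inj u : (forall p q l, tensor_form h p q l u = 0) -> u = 0.
Proof.
move=> u0; apply: tensor_eval_inj => T.
have [/existsP[p /existsP[q /existsP[l /eqP->]]]|NT] :=
    boolP [exists p : I, exists q : I, exists l : h.-tuple I, T == row_tabloid p
      q l].
  by have := u0 p q l; rewrite /tensor_form size_tuple eqxx.
rewrite /tensor_eval big1 // => j _.
have vX : {subset U <= <<[seq polytabloid K T | T <- Tab n (near_hook_shape n
  h)]>>%VS}.
  by move=> v; rewrite UE.
have := vX _ (vbasis_nth_mem j); move: _`_j.
suff v0 : forall v : tabloid_space K n,
    v \in <<[seq polytabloid K T | T <- Tab n (near_hook_shape n h)]>>%VS -> v T
      = 0.
  by move=> v /v0->; rewrite scale0r.
apply: (@span_ind _ _ (fun v : tabloid_space K n => v T = 0)) => [|c v v'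
  /mapP[T' T'T ->] v0].
  by rewrite ffunE.
rewrite !ffunE v0 addr0 polytabloidE.
have [x [y [s [z [w [t [TE th pe]]]]]]] := Tab_near_hookP hn T'T.
rewrite big1 ?scaler0 // => g _; rewrite TE act_near_hook.
case: eqP => [E|_]; last by rewrite mulr0.
case/negP: NT; apply/existsP; exists (g z); apply/existsP; exists (g w).
have st : size (map g t) == h by rewrite size_map th.
apply/existsP; exists (Tuple st); rewrite E; apply/eqP/tabloid_of_near_hook.
rewrite -[X in perm_eq X](_ : map g ([:: x, z & t] ++ [:: y; w] ++ s) = _);
  last first.
  by rewrite !map_cat.
apply: uniq_perm; rewrite ?enum_uniq // ?map_inj_uniq ?(perm_uniq pe) ?enum_uniq //.
  exact: perm_inj.
by move=> v1; rewrite mem_enum -[v1](permKV g) map_f // (perm_mem pe) mem_enum.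
Qed.

Lemma tensor_form_surj f : specht_form h f ->
  exists u, forall p q l, tensor_form h p q l u = f p q l.
Proof.
move=> /(specht_form_span charK0 hn)[c cE].
pose rest (a : seq I) := [seq v <- enum I | v \notin a].
exists (\sum_(a <- words I h.+2) \sum_b1 \sum_(b2 | uniq (a ++ [:: b1; b2]))
  tens U (polytabloid K (tableau2 a [:: b1; b2] (rest (a ++ [:: b1;
    b2])))) (c a b1 b2)).
move=> p q l; rewrite cE linear_sum; apply: eq_big_seq => a /size_words sa.
rewrite linear_sum; apply: eq_bigr => b1 _; rewrite linear_sum.
apply: eq_bigr => b2 u_ab.
case: a sa u_ab => [|x [|z t]] //= [th] u_ab.
rewrite tableau2E tensor_form_polytabloid //.
by rewrite catA; apply: (perm_eq_rest (s := [:: x, z & t] ++ [:: b1; b2])).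
Qed.

End SpechtTensor.

(** * The sign module of shape $(1^n)$ *)

Section SignModule.
Variables (K : fieldType) (n : nat).
Hypothesis n_gt0 : (0 < n)%N.
Notation R := {mpoly K[n]}.
Notation I := 'I_n.
Notation T0 := (tableau_of_columns [:: enum I]).
Notation e0 := (polytabloid K T0).

Lemma column_tableauE : T0 = singles (enum I).
Proof.
have := size_enum_ord n; case: (enum I) => [|x s] sn.
  by move: n_gt0; rewrite -sn.
exact: transpose_column.
Qed.

Lemma column_stab_singles (s : seq I) : perm_eq s (enum I) ->
  column_stab (singles s) = [set: 'S_n].
Proof.
move=> sE; apply/setP => g; rewrite !inE; apply/allP => c.
case: s sE => [|x s] sE; first by rewrite /columns /transpose.
rewrite /columns transpose_singles mem_seq1 => /eqP->.
by apply/allP => v _; rewrite (perm_mem sE) mem_enum.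
Qed.

Lemma act_singles (g : 'S_n) (s : seq I) : act_tableau g (singles s) = singles
  (map g s).
Proof. by rewrite /act_tableau /singles -!map_comp. Qed.

Lemma polytabloid_singles (s : seq I) : perm_eq s (enum I) ->
  exists c : K, polytabloid K (singles s) = c *: e0.
Proof.
move=> sE; have [g gE] := perm_eq_enum_perm (perm_refl (enum I)) sE.
exists ((-1) ^+ odd_perm g).
rewrite column_tableauE /polytabloid !column_stab_singles // scaler_sumr.
rewrite (reindex_inj (mulgI g^-1%g)) /=.
apply: eq_big => [h|h _]; first by rewrite !inE.
rewrite scalerA odd_permM odd_permV signr_addb; congr (_ *: tabloid_vec _ _).
rewrite !act_singles -gE -map_comp; congr (tabloid_of (singles _)).
by apply: eq_map => v; rewrite /= permM permK.
Qed.

Lemma polytabloid_column_eval : (e0 (tabloid_of T0) : K) = 1.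
Proof.
rewrite polytabloidE column_tableauE column_stab_singles // (bigD1 1%g) ?inE //=.
rewrite act_singles odd_perm1 expr0 mul1r.
rewrite (_ : map _ _ = enum I) ?eqxx; last by apply: map_id_in => v _;
  rewrite perm1.
rewrite big1 ?addr0 // => g /andP[_ g1]; case: eqP => [E|_]; last by rewrite mulr0.
case/eqP: g1; apply/permP => v; rewrite perm1.
have := congr1 (fun f : tabloid n => f v) E; rewrite !ffunE act_singles.
have nthS (s : seq I) : size s = n -> nth [::] (singles s) v = [:: nth v s v].
  by move=> sn; rewrite (nth_map v) ?sn.
have sE := size_enum_ord n.
rewrite (nthS _ sE) (nthS _ (etrans (size_map g _) sE)) (nth_map v) ?sE //.
rewrite nth_ord_enum => /setP/(_ v).
by rewrite !inE eqxx => /esym/eqP.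
Qed.

Lemma TabPcolumn T : T \in Tab n (nseq n 1%N) ->
  exists2 s, T = singles s & perm_eq s (enum I).
Proof.
rewrite mem_Tab; last by rewrite sumn_nseq mul1n.
case/andP=> /eqP shT pe.
have [s TE] := shape_nseq1 shT.
by exists s => //; rewrite -(flatten_singles s) -TE.
Qed.

Lemma column_Tab : T0 \in Tab n (nseq n 1%N).
Proof.
rewrite mem_Tab ?sumn_nseq ?mul1n // column_tableauE shape_singles size_enum_ord
  eqxx.
by rewrite flatten_singles perm_refl.
Qed.

Variable U : {vspace tabloid_space K n}.
Hypothesis UE : U = specht_module K n (nseq n 1%N).

Lemma column_mem : e0 \in U.
Proof. by rewrite UE memv_span // map_f // column_Tab. Qed.

Lemma sign_tensorP (u : tensor U) : exists r, u = r *: tens U e0 1.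
Proof.
move: u; apply: (tensor_ind UE) => [|u v [r ->] [r' ->]|r v /mapP[T /TabPcolumn[s
  -> sE] ->]].
- by exists 0; rewrite scale0r.
- by exists (r + r'); rewrite scalerDl.
have [c ->] := polytabloid_singles sE.
by exists (r * c%:MP); rewrite tensZ scalerA.
Qed.

End SignModule.

(** * The differentials *)

Section Differentials.
Variables (K : fieldType) (charK0 : [pchar K] =i pred0) (n : nat).
Notation R := {mpoly K[n]}.
Notation I := 'I_n.
Notation X := (fun a : I => 'X_a : R).
Implicit Types (z : I -> I -> seq I -> R).

Lemma specht_form_contract h z : specht_form h.+1 z ->
  specht_form h (fun p q => contract X (z p q)).
Proof.
case=> z_alt z_sym z_diag z_cyc z_sum z_deg; split.
- by move=> p q; apply: alternating_contract.
- by move=> p q l; apply: eq_bigr => a _; rewrite z_sym.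
- by move=> p l; rewrite contract0.
- move=> p q r l; rewrite /contract -!big_split big1 // => a _ /=.
  rewrite (alternating2 a r _ (z_alt p q)) (alternating2 a p _ (z_alt q r)).
  rewrite (alternating2 a q _ (z_alt r p)).
  transitivity (- ('X_a * (z p q [:: r, a & l] + z q r [:: p, a & l] + z r p [::
    q, a & l]))).
    by ring.
  by rewrite z_cyc mulr0 oppr0.
- move=> p l; rewrite exchange_big big1 // => a _.
  by rewrite -mulr_sumr z_sum mulr0.
by move=> p q; apply: degree_contract.
Qed.

Lemma eq_koszul_cycle h z z' : (forall p q l, z p q l = z' p q l) ->
  koszul_cycle h z -> koszul_cycle h z'.
Proof.
move=> zz [dz ez]; split=> [p q l|h0].
  by rewrite -[RHS](dz p q l); apply: eq_bigr => a _; rewrite zz.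
by rewrite -[RHS](ez h0); apply: eq_bigr => p _; apply: eq_bigr => q _; rewrite zz.
Qed.

Lemma koszul_cycleM h c z : koszul_cycle h z ->
  koszul_cycle h (fun p q l => c * z p q l).
Proof.
move=> [dz ez]; split=> [p q l|h0]; first by rewrite contractM dz mulr0.
rewrite -[RHS](mulr0 c) -[in RHS](ez h0) mulr_sumr; apply: eq_bigr => p _.
by rewrite mulr_sumr; apply: eq_bigr => q _; ring.
Qed.

Lemma tensor_form_tableau2 h (U : {vspace tabloid_space K n}) (a c : seq I) y w r
  p q l :
  (h + 4 <= n)%N -> U = specht_module K n (near_hook_shape n h) ->
  size a = h.+2 -> perm_eq (a ++ [:: y; w] ++ c) (enum I) ->
  tensor_form h p q l (tens U (polytabloid K (tableau2 a [:: y; w] c)) r) =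
  r * gen_form a y w p q l.
Proof.
move=> hn UE; case: a => [|x [|z t]] //= [th] pe.
by rewrite tableau2E tensor_form_polytabloid.
Qed.

Section Middle.
Variables (h : nat) (hn : (h + 5 <= n)%N).
Variables U1 U2 : {vspace tabloid_space K n}.
Hypothesis UE1 : U1 = specht_module K n (near_hook_shape n h).
Hypothesis UE2 : U2 = specht_module K n (near_hook_shape n h.+1).

Let hn1 : (h + 4 <= n)%N. Proof. lia. Qed.
Let hn2 : (h.+1 + 4 <= n)%N. Proof. lia. Qed.

Definition middle_value (a b c : seq I) : tensor U1 :=
  \sum_(j < size a)
    let aj := tnth (in_tuple a) j in
    let Tj := tableau2 (take j a ++ drop j.+1 a) b (rcons c aj) in
    (-1) ^+ j *: tens U1 (polytabloid K Tj) 'X_aj.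

Definition is_middle (d : tensor U2 -> tensor U1) := forall T a b c,
  T \in Tab n (near_hook_shape n h.+1) ->
  columns T = [:: a, b & [seq [:: x] | x <- c]] ->
  d (tens U2 (polytabloid K T) 1) = middle_value a b c.

Lemma middle_value_form a y w c p q l : size a = h.+3 ->
  perm_eq (a ++ [:: y; w] ++ c) (enum I) ->
  tensor_form h p q l (middle_value a [:: y; w] c) =
  contract X (gen_form a y w p q) l.
Proof.
move=> sa pe; rewrite contract_gen_form linear_sum; apply: eq_bigr => j _.
set aj := tnth _ j; rewrite linearZ /= (tensor_form_tableau2 _ _ _ _ hn1 UE1);
  first exact: mulrA.
  rewrite size_cat size_take size_drop ltn_ord.
  by move: (ltn_ord j); move: (nat_of_ord j) => k; rewrite sa => kl; lia.
apply: perm_trans pe; rewrite -[X in perm_eq _ (X ++ _)](cat_take_drop j a).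
have ajE : nth aj a j = aj := esym (tnth_nth aj (in_tuple a) j).
rewrite (drop_nth aj (ltn_ord j)) ajE.
by apply/seq.permP => P; rewrite -cats1 !count_cat /= ?count_cat /=; lia.
Qed.

(** Both sides are linear, and on polytabloids this is [contract_gen_form]. *)
Lemma middle_form (d : {linear tensor U2 -> tensor U1}) : is_middle d ->
  forall u p q l, tensor_form h p q l (d u) =
    contract X (fun l => tensor_form h.+1 p q l u) l.
Proof.
move=> dP u p q l; elim/(tensor_ind_polytabloid hn2 UE2): u => [|u v uE vE|r x y
  s z w t th pe].
- by rewrite !linear0 contract0 // => m _; rewrite linear0.
- rewrite linearD [LHS]linearD /= uE vE -contractD; apply: eq_contract => m _.
  by rewrite linearD.
rewrite linearZ [LHS]linearZ /=.
rewrite (dP _ [:: x, z & t] [:: y; w] s); first last.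
- exact: transpose_near_hook.
- exact: Tab_near_hook.
rewrite middle_value_form ?th //= ?th //.
rewrite [LHS](esym (contractM _ _ _ _)); apply: eq_contract => m _.
by rewrite linearZ /= (tensor_form_polytabloid charK0 hn2 UE2) // mul1r.
Qed.

(** Compatibility with the relations among the $e(T)$: on a basis, take the tensor whose form is the
    contracted one; injectivity of forms then yields the formula on every $e(T)$. *)
Lemma middle_exists : exists d : {linear tensor U2 -> tensor U1}, is_middle d.
Proof.
have ex (j : 'I_(\dim U2)) : exists v : tensor U1, forall p q l,
    tensor_form h p q l v =
    contract X (fun l => tensor_form h.+1 p q l (tens U2 (vbasis U2)`_j 1)) l.
  apply: (tensor_form_surj charK0 hn1 UE1).
  exact: specht_form_contract (specht_form_tensor charK0 hn2 UE2 _).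
have [v vE] := fin_all_exists ex.
exists (rowlin v) => T a b c /(Tab_near_hookP hn2).
move=> [x [y [s [z [w [t [-> th pe]]]]]]].
rewrite /columns transpose_near_hook => -[<- <- /singles_inj <-].
apply/eqP; rewrite -subr_eq0; apply/eqP/(tensor_form_inj hn1 UE1) => p q l.
have sx : size [:: x, z & t] = h.+3 by rewrite /= th.
rewrite linearB [X in _ - X](middle_value_form p q l sx pe) /=.
apply/eqP; rewrite subr_eq0; apply/eqP.
transitivity (contract X (fun l => tensor_form h.+1 p q l
  (tens U2 (polytabloid K (near_hook x y s z w t)) 1)) l); last first.
  apply: eq_contract => m _.
  by rewrite (tensor_form_polytabloid charK0 hn2 UE2) // mul1r.
move: (tens U2 _ 1) => u; rewrite /rowlin /= /rowlin_fun linear_sum.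
rewrite (eq_bigr (fun k => u 0 k * contract X (fun l =>
  tensor_form h.+1 p q l (tens U2 (vbasis U2)`_k 1)) l)); last first.
  by move=> k _; rewrite linearZ /= vE.
rewrite -contract_sum; apply: eq_contract => m _.
rewrite [in RHS](tensor_basis u) linear_sum; apply: eq_bigr => k _.
by rewrite linearZ.
Qed.

End Middle.

Section First.
Hypothesis hn : (0 + 4 <= n)%N.
Variable U : {vspace tabloid_space K n}.
Hypothesis UE : U = specht_module K n (near_hook_shape n 0).

Definition is_first (d : tensor U -> R) := forall T, T \in Tab n (near_hook_shape
  n 0) ->
  d (tens U (polytabloid K T) 1) = specht_poly K T.

Lemma specht_col1 (x : I) : specht_col K [:: x] = 1.
Proof. by rewrite /specht_col big_ord1 big_mkcond big_ord1. Qed.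

Lemma specht_col2 (x y : I) : specht_col K [:: x; y] = 'X_x - 'X_y.
Proof.
rewrite /specht_col big_ord_recl big_ord1 [X in X * _]big_mkcond [X in _ *
  X]big_mkcond.
by rewrite !big_ord_recl !big_ord0 /= !(tnth_nth x) /= !mulr1 mul1r.
Qed.

Lemma specht_poly_near_hook (x y z w : I) s :
  specht_poly K (near_hook x y s z w [::]) = ('X_x - 'X_z) * ('X_y - 'X_w).
Proof.
rewrite /specht_poly /columns transpose_near_hook !big_cons !specht_col2.
rewrite big_map big1 ?mulr1 // => v _; exact: specht_col1.
Qed.

Definition eval_form (z : I -> I -> seq I -> R) : R :=
  \sum_p \sum_q 'X_p * 'X_q * z p q [::].

Lemma first_form (d : {linear tensor U -> R^o}) : is_first d ->
  forall u, d u *+ 2 = eval_form (fun p q l => tensor_form 0 p q l u).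
Proof.
move=> dP u; elim/(tensor_ind_polytabloid hn UE): u => [|u v uE vE|r x y s z w t
  th pe].
- by rewrite linear0 mul0rn /eval_form big1 // => p _; rewrite big1 // => q _;
  rewrite linear0 mulr0.
- rewrite linearD mulrnDl /= uE vE /eval_form -big_split; apply: eq_bigr => p _.
  by rewrite -big_split; apply: eq_bigr => q _; rewrite linearD /= mulrDr.
rewrite linearZ /= dP ?Tab_near_hook //.
case: t th pe => // th pe; rewrite specht_poly_near_hook -mulrnAr.
rewrite -(eval_gen_form K x z y w) mulr_sumr /eval_form; apply: eq_bigr => p _.
rewrite mulr_sumr; apply: eq_bigr => q _.
rewrite linearZ /= (tensor_form_polytabloid charK0 hn UE) // mul1r.
exact: mulrCA.
Qed.

Lemma first_exists : exists d : {linear tensor U -> R^o}, is_first d.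
Proof.
pose v (j : 'I_(\dim U)) : R^o := (2%:R^-1 : K) *: (eval_form (fun p q l =>
  tensor_form 0 p q l (tens U (vbasis U)`_j 1)) : R).
exists (rowlin v) => T /(Tab_near_hookP hn) [x [y [s [z [w [t [-> th pe]]]]]]].
have E (u : tensor U) : rowlin v u = (2%:R^-1 : K) *:
    (eval_form (fun p q l => tensor_form 0 p q l u) : R) :> R.
  transitivity ((2%:R^-1 : K) *: (\sum_j u 0 j * \sum_p \sum_q 'X_p * 'X_q *
      tensor_form 0 p q [::] (tens U (vbasis U)`_j 1) : R)).
    by rewrite scaler_sumr; apply: eq_bigr => j _; rewrite scalerAr.
  congr (_ *: _); rewrite /eval_form; under eq_bigr do rewrite mulr_sumr.
  rewrite exchange_big; apply: eq_bigr => p _.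
  under eq_bigr do rewrite mulr_sumr.
  rewrite exchange_big; apply: eq_bigr => q _.
  rewrite [in RHS](tensor_basis u) linear_sum mulr_sumr; apply: eq_bigr => j _.
  by rewrite linearZ /= mulrCA.
rewrite E; case: t th pe => // th pe; rewrite specht_poly_near_hook.
rewrite [RHS](natKV charK0 (esym (eval_gen_form K x z y w))).
congr (_ *: _); apply: eq_bigr => p _; apply: eq_bigr => q _.
by rewrite (tensor_form_polytabloid charK0 hn UE) // mul1r.
Qed.

End First.

End Differentials.

(** * The last differential *)

Section Last.
Variables (K : fieldType) (charK0 : [pchar K] =i pred0) (n : nat).
Notation R := {mpoly K[n]}.
Notation I := 'I_n.
Notation X := (fun a : I => 'X_a : R).
Variables (h : nat) (hn : (h + 4 = n)%N).
Variables U1 U2 : {vspace tabloid_space K n}.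
Hypothesis UE1 : U1 = specht_module K n (near_hook_shape n h).
Hypothesis UE2 : U2 = specht_module K n (nseq n 1%N).
Notation e0 := (polytabloid K (tableau_of_columns [:: enum I])).

Let hn1 : (h + 4 <= n)%N. Proof. lia. Qed.
Let n_gt0 : (0 < n)%N. Proof. lia. Qed.

Definition last_value : tensor U1 :=
  \sum_(j < n) \sum_(k < n | (j < k)%N)
    let Tjk := tableau2 [seq x <- enum I | x \notin [:: j; k]] [:: j; k] [::] in
    (-1) ^+ (j + k + 1) *: tens U1 (polytabloid K Tjk) ('X_j * 'X_k).

Definition is_last (d : tensor U2 -> tensor U1) := d (tens U2 e0 1) = last_value.

Lemma last_value_form p q l : tensor_form h p q l last_value = top_form p q l.
Proof.
rewrite -(top_form_gen charK0) linear_sum; apply: eq_bigr => j _.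
rewrite linear_sum; apply: eq_bigr => k jk; rewrite linearZ /=.
have ujk : uniq [:: j; k] by rewrite /= inE andbT; apply: contraTneq jk => ->;
  rewrite ltnn.
have pe : perm_eq ([seq x <- enum I | x \notin [:: j; k]] ++ [:: j;
  k] ++ [::]) (enum I).
  by rewrite cats0 perm_catC perm_eq_rest.
have sa : size [seq x <- enum I | x \notin [:: j; k]] = h.+2.
  by have := perm_size pe; rewrite !size_cat size_enum_ord /=; lia.
rewrite (tensor_form_tableau2 charK0 _ _ _ _ hn1 UE1) //; exact: mulrA.
Qed.

Lemma last_exists : exists d : {linear tensor U2 -> tensor U1}, is_last d.
Proof.
pose t0 := tabloid_of (tableau_of_columns [:: enum I]) : tabloid n.
(* Evaluation at the tabloid of the column serves as the coordinate along [e0], where it takes the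
   value 1. *)
exists (rowlin (fun j => (tensor_eval t0 (tens U2 (vbasis U2)`_j 1) : R) *:
  last_value)).
rewrite /is_last /rowlin /= /rowlin_fun; under eq_bigr do rewrite scalerA.
rewrite -scaler_suml -[RHS]scale1r; congr (_ *: _).
have e1 : tensor_eval t0 (tens U2 e0 1) = 1.
  rewrite tensor_eval_tens ?(column_mem n_gt0 UE2) //.
  by rewrite (polytabloid_column_eval K n_gt0) scale1r.
rewrite -[RHS]e1 [in RHS](tensor_basis (tens U2 e0 1)) linear_sum.
by apply: eq_bigr => j _; rewrite linearZ.
Qed.

Variable d : {linear tensor U2 -> tensor U1}.
Hypothesis dP : is_last d.

Lemma last_form u : exists2 r, u = r *: tens U2 e0 1 &
  forall p q l, tensor_form h p q l (d u) = r * top_form p q l.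
Proof.
have [r ->] := sign_tensorP n_gt0 UE2 u; exists r => // p q l.
by rewrite linearZ [LHS]linearZ /= dP last_value_form.
Qed.

Lemma last_inj u : d u = 0 -> u = 0.
Proof.
move=> du; have [r uE dE] := last_form u.
have n4 : (4 <= n)%N by lia.
have [p [q [l [_ tf]]]] := top_form_neq0 charK0 n4.
have := dE p q l; rewrite du linear0 => /esym/eqP.
by rewrite mulf_eq0 (negPf tf) orbF => /eqP r0; rewrite uE r0 scale0r.
Qed.

End Last.

(** * Gradings, freeness and the irrelevant ideal *)

Section Graded.
Variables (K : fieldType) (n : nat).
Notation R := {mpoly K[n]}.

Lemma shifted_homog0 a e : shifted_homog a e (0 : R).
Proof. by rewrite /shifted_homog; case: ifP; rewrite ?rpred0. Qed.

Lemma shifted_homogD a e (p q : R) :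
  shifted_homog a e p -> shifted_homog a e q -> shifted_homog a e (p + q).
Proof.
rewrite /shifted_homog; case: ifP => _; first exact: rpredD.
by move=> /eqP-> /eqP->; rewrite addr0.
Qed.

Lemma shifted_homogM a b e (p q : R) : (b <= a)%N ->
  shifted_homog a e p -> q \is (a - b).-homog -> shifted_homog b e (p * q).
Proof.
rewrite {1}/shifted_homog => ba; case: ifP => [ae pe qe|_ /eqP-> _]; last first.
  by rewrite mul0r shifted_homog0.
rewrite /shifted_homog (leq_trans ba ae).
by rewrite (_ : (e - b = (e - a) + (a - b))%N) ?dhomogM //; lia.
Qed.

Section Map.
Variables (U : {vspace tabloid_space K n}) (Xs : seq (tabloid_space K n)) (W :
  lmodType R).
Hypothesis UX : U = <<Xs>>%VS.
Variable d : {linear tensor U -> W}.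

Lemma homog_generators (c : W -> R) e : linear (c : W -> R^o) ->
  (forall x, x \in Xs -> c (d (tens U x 1)) \is e.-homog) ->
  forall v, v \in U -> c (d (tens U v 1)) \is e.-homog.
Proof.
move=> c_lin cX v; have -> : (v \in U) = (v \in <<Xs>>%VS) by rewrite -UX.
have c0 : c 0 = 0.
  by have := c_lin (-1) 0 0; rewrite scaler0 addr0 scaleN1r addNr.
apply: (@span_ind _ _ (fun v => c (d (tens U v 1)) \is e.-homog)) => [|k x w xX wh].
  by rewrite tens0 linear0 c0 rpred0.
rewrite tensD tensZ linearP c_lin rpredD //.
by rewrite /GRing.scale /= mul_mpolyC rpredZ // cX.
Qed.

(** The basis vectors are [K]-combinations of the spanning set, so homogeneity of degree [a - b] may
    be tested on the latter. *)
Lemma shifted_homog_map (c : W -> R) a b e (u : tensor U) :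
  linear (c : W -> R^o) -> (b <= a)%N ->
  (forall x, x \in Xs -> c (d (tens U x 1)) \is (a - b).-homog) ->
  (forall j, shifted_homog a e (u 0 j)) -> shifted_homog b e (c (d u)).
Proof.
move=> c_lin ba cX ue; rewrite (tensor_basis u) linear_sum.
have c0 : c 0 = 0.
  by have := c_lin (-1) 0 0; rewrite scaler0 addr0 scaleN1r addNr.
elim/big_rec: _ => [|j w _ cw]; first by rewrite c0 shifted_homog0.
rewrite linearZ c_lin; apply: shifted_homogD => //;
  apply: shifted_homogM ba _ _ => //.
by apply: homog_generators c_lin cX _ _; apply: vbasis_nth_mem.
Qed.

End Map.

Section Irrelevant.
Variable M : gmod K n.
Implicit Types y : M.

Lemma in_irrelevant0 : in_irrelevant (0 : M).
Proof. by exists (fun=> 0); rewrite big1 // => k _; rewrite scaler0. Qed.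

Lemma in_irrelevantD y y' : in_irrelevant y -> in_irrelevant y' -> in_irrelevant
  (y + y').
Proof.
move=> [z ->] [z' ->]; exists (fun k => z k + z' k).
by rewrite -big_split; apply: eq_bigr => k _; rewrite scalerDr.
Qed.

Lemma in_irrelevantZ r y : in_irrelevant y -> in_irrelevant (r *: y).
Proof.
move=> [z ->]; exists (fun k => r *: z k).
by rewrite scaler_sumr; apply: eq_bigr => k _; rewrite !scalerA mulrC.
Qed.

Lemma in_irrelevantX a y : in_irrelevant ('X_a *: y).
Proof.
exists (fun k => if k == a then y else 0).
rewrite (bigD1 a) //= eqxx big1 ?addr0 // => k /negPf->.
by rewrite scaler0.
Qed.

Lemma in_irrelevant_sum (J : Type) (r : seq J) (P : pred J) (F : J -> M) :
  (forall j, P j -> in_irrelevant (F j)) -> in_irrelevant (\sum_(j <- r | P j) F j).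
Proof.
by move=> PF; apply: big_ind => //; [exact: in_irrelevant0|exact: in_irrelevantD].
Qed.

End Irrelevant.

Lemma graded_free_gtensor U a : graded_free (@gtensor K n U a).
Proof.
exists (\dim U), (fun j => delta_mx 0 j), (fun=> a).
have entry (c : {ffun 'I_(\dim U) -> R}) j : (\sum_i c i *: delta_mx 0 i : tensor
  U) 0 j = c j.
  rewrite summxE (bigD1 j) //= !mxE !eqxx mulr1 big1 ?addr0 // => i /negPf ij.
  by rewrite !mxE eq_sym ij mulr0.
split=> [x|e c].
  exists [ffun j => x 0 j]; split=> [|c ->].
    by apply/rowP => j; rewrite entry ffunE.
  by apply/ffunP => j; rewrite ffunE entry.
by split=> ch j; have := ch j; rewrite entry.
Qed.

Lemma graded_free_gpoly : graded_free (gpoly K n).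
Proof.
exists 1%N, (fun=> 1), (fun=> 0%N); split=> [x|e c].
  exists [ffun=> x]; split=> [|c ->]; first by rewrite big_ord1 ffunE [RHS]mulr1.
  by apply/ffunP => j; rewrite ffunE big_ord1 (ord1 j) [LHS]mulr1.
rewrite big_ord1 /= [_ *: _]mulr1 /shifted_homog /= subn0.
by split=> [? i|/(_ ord0)] //; rewrite (ord1 i).
Qed.

End Graded.

(** * The resolution *)

Section Resolution.
Variables (n : nat) (n_ge4 : (4 <= n)%N).
Variables (K : fieldType) (charK0 : [pchar K] =i pred0).
Notation R := {mpoly K[n]}.
Notation I := 'I_n.
Notation X := (fun a : I => 'X_a : R).
Notation S i := (resolution_specht K n i).

Lemma near_hook_shapeE i :
  [:: n - 1 - i.+1, 2 & nseq i 1]%N = near_hook_shape n i.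
Proof. by rewrite /near_hook_shape; congr [:: _, _ & _]; lia. Qed.

Lemma resolution_middle i : (i + 4 <= n)%N ->
  S i.+1 = specht_module K n (near_hook_shape n i).
Proof.
move=> hn; rewrite /resolution_specht ifT; last by lia.
by rewrite [(i.+1 - 1)%N]subSS subn0 near_hook_shapeE.
Qed.

Lemma resolution_last i : (i + 3 = n)%N -> S i.+1 = specht_module K n (nseq n 1%N).
Proof. by move=> hn; rewrite /resolution_specht ifF ?ifT //; lia. Qed.

Lemma resolution_trivial i (u v : tensor (S i.+1)) : (n < i + 3)%N -> u = v.
Proof.
move=> hn; have S0 : S i.+1 = 0%VS by rewrite /resolution_specht !ifF //; lia.
have: \dim (S i.+1) = 0%N by rewrite S0 dimv0.
by move: u v; rewrite /tensor; case: (\dim _) => // u v _; apply/rowP => -[].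
Qed.

(** Both clauses are gathered for one index, so that a single choice yields the whole family; beyond
    the last index the zero map serves. *)
Lemma step_exists i : exists d : {linear tensor (S i.+2) -> tensor (S i.+1)},
  ((i.+2 <= n - 3)%N -> is_middle i d) /\ (i.+2 = (n - 2)%N -> is_last d).
Proof.
have [hn|hn] := leqP (i + 5) n.
  have hn1 : (i + 4 <= n)%N by lia.
  have hn2 : (i.+1 + 4 <= n)%N by lia.
  have [d dP] := middle_exists charK0 hn (resolution_middle hn1)
    (resolution_middle hn2).
  by exists d; split=> [//|]; lia.
have [hn4|hn4] := eqVneq (i + 4)%N n.
  have hn1 : (i + 4 <= n)%N by lia.
  have hn2 : (i.+1 + 3 = n)%N by lia.
  have [d dP] := last_exists hn4 (S i.+1) (resolution_last hn2).
  by exists d; split=> [|//]; lia.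
by exists (rowlin (fun=> 0)); split; lia.
Qed.

Lemma differential_exists : exists d : forall i : nat,
  {linear resolution_module K n i.+1 -> resolution_module K n i},
  resolution_differential d.
Proof.
have hn0 : (0 + 4 <= n)%N by [].
have [d0 d0P] := first_exists charK0 hn0 (resolution_middle hn0).
(* The family is data, while [step_exists] is only a proposition. *)
have ex i := ClassicalEpsilon.constructive_indefinite_description _ (step_exists i).
pose d i : {linear resolution_module K n i.+1 -> resolution_module K n i} :=
  if i is j.+1 then sval (ex j) else d0.
exists d; split.
- move=> T TT; apply: d0P; move: TT.
  by rewrite -(near_hook_shapeE 0) -subnDA.
- move=> i hi T a b c TT cT; have [mid _] := svalP (ex i).
  by apply: (mid hi); rewrite // -near_hook_shapeE.
- by move=> i hi; have [_ last] := svalP (ex i); apply: (last hi).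
Qed.

Variable d : forall i : nat,
  {linear resolution_module K n i.+1 -> resolution_module K n i}.
Hypothesis dP : resolution_differential d.

Let d0 : {linear tensor (S 1) -> R^o} := d 0.
Let dS i : {linear tensor (S i.+2) -> tensor (S i.+1)} := d i.+1.

Let firstP : is_first d0.
Proof.
move=> T TT; apply: (differential_first dP).
by move: TT; rewrite -(near_hook_shapeE 0) -subnDA.
Qed.

Let middleP i : (i + 5 <= n)%N -> is_middle i (dS i).
Proof.
move=> hn T a b c TT cT; apply: (differential_middle dP);
  rewrite ?near_hook_shapeE //; lia.
Qed.

Let lastP i : (i + 4 = n)%N -> is_last (dS i).
Proof. by move=> hn; apply: (differential_last dP); lia. Qed.

Lemma differential_eq0 i (u : tensor (S i.+1)) : (i + 4 <= n)%N ->
  (d i u = 0) <-> koszul_cycle i (fun p q l => tensor_form i p q l u).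
Proof.
move=> hn; have uf := specht_form_tensor charK0 hn (resolution_middle hn) u.
case: i u hn uf => [|i] u hn uf.
  have dE := first_form charK0 hn (resolution_middle hn) firstP u.
  split=> [du|[_ /(_ erefl) ez]].
    split=> [p q l|_]; first by rewrite contract0 // => m sm; apply: (sf_deg uf);
      rewrite sm.
    by rewrite -[LHS]dE [d0 u]du mul0rn.
  by apply: (mulrnI0 charK0 (k := 1)); rewrite [LHS]dE.
have hn1 : (i + 4 <= n)%N by lia.
have hn5 : (i + 5 <= n)%N by lia.
have dE := middle_form charK0 hn5 (resolution_middle hn1) (resolution_middle hn)
  (middleP hn5) u.
split=> [du|[ez _]].
  by split=> // p q l; rewrite -dE [dS i u]du linear0.
by apply: (tensor_form_inj hn1 (resolution_middle hn1)) => p q l; rewrite dE.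
Qed.

(** [differential_eq0] turns kernels into Koszul cycles. The two exactness theorems treat $F_{i+1}$
    for $i+5\le n$ and $i+4=n$; after that, injectivity is left. *)
Lemma differential_exact i (u : resolution_module K n i.+1) :
  d i u = 0 <-> exists v : resolution_module K n i.+2, u = d i.+1 v.
Proof.
have [hn5|hn5] := leqP (i + 5) n.
  have hn : (i + 4 <= n)%N by lia.
  have hn2 : (i.+1 + 4 <= n)%N by lia.
  have UE1 := resolution_middle hn; have UE2 := resolution_middle hn2.
  have dE := middle_form charK0 hn5 UE1 UE2 (middleP hn5).
  rewrite (differential_eq0 u hn); split=> [uc|[v ->]].
    have uf := specht_form_tensor charK0 hn UE1 u.
    have [z zf zE] := specht_form_exact charK0 hn5 uf uc.
    have [v vE] := tensor_form_surj charK0 hn2 UE2 zf.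
    exists v; apply/eqP; rewrite -subr_eq0; apply/eqP.
    apply: (tensor_form_inj hn UE1) => p q l.
    rewrite linearB [X in _ - X]dE /=; apply/eqP; rewrite subr_eq0; apply/eqP.
    by rewrite -[LHS]zE; apply: eq_contract => m _; rewrite vE.
  apply: eq_koszul_cycle (koszul_cycle_contract charK0 (specht_form_tensor charK0
    hn2 UE2 v)).
  by move=> p q l; rewrite [RHS]dE.
have [hn|hn] := eqVneq (i + 4)%N n.
  have hn4 : (i + 4 <= n)%N by lia.
  have UE1 := resolution_middle hn4.
  have UE2 : S i.+2 = specht_module K n (nseq n 1%N) by apply: resolution_last; lia.
  have dE := last_form charK0 hn UE1 UE2 (lastP hn).
  rewrite (differential_eq0 u hn4); split=> [uc|[v ->]].
    have uf := specht_form_tensor charK0 hn4 UE1 u.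
    have [r uE] := specht_form_exact_top charK0 hn uf uc.
    exists (r *: tens (S i.+2) (polytabloid K (tableau_of_columns [:: enum I])) 1).
    rewrite linearZ [X in _ = _ *: X](lastP hn).
    apply/eqP; rewrite -subr_eq0; apply/eqP.
    apply: (tensor_form_inj hn4 UE1) => p q l.
    rewrite linearB [X in X - _]uE linearZ /= (last_value_form charK0 hn UE1).
    exact: subrr.
  have [r _ vE] := dE v.
  apply: eq_koszul_cycle (koszul_cycleM r _); first by move=> p q l;
    rewrite [RHS]vE.
  have ni : i = (n - 4)%N by lia.
  by rewrite ni; apply: top_form_cycle.
split=> [du|[v ->]]; last by rewrite (resolution_trivial v 0) ?linear0 //; lia.
exists 0; rewrite linear0.
have [hn3|hn3] := eqVneq (i + 3)%N n; last by apply: resolution_trivial; lia.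
case: i u hn5 hn hn3 du => [|i] u hn5 hn hn3 du; first by lia.
have hn4 : (i + 4 = n)%N by lia.
apply: (last_inj charK0 hn4 _ _ (lastP hn4) du).
  by apply: resolution_middle; lia.
by apply: resolution_last; lia.
Qed.

Lemma homogX (a : I) : ('X_a : R) \is 1.-homog.
Proof. by rewrite dhomogX; apply/eqP; apply: mdeg1. Qed.

Lemma tens_entry_homog U v (r : R) e k :
  r \is e.-homog -> (tens U v r : tensor U) 0 k \is e.-homog.
Proof. by move=> re; rewrite mxE rpredZ. Qed.

Lemma middle_value_homog i a b c k : (middle_value (S i.+1) a b c) 0 k \is 1.-homog.
Proof.
rewrite summxE rpred_sum // => j _; rewrite mxE rpredMsign.
exact/tens_entry_homog/homogX.
Qed.

Lemma last_value_homog i k : (last_value (S i.+1)) 0 k \is 2.-homog.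
Proof.
rewrite summxE rpred_sum // => j _; rewrite summxE rpred_sum // => j' _.
by rewrite mxE rpredMsign; apply: tens_entry_homog;
  apply: (@dhomogM _ _ _ 1 _ 1); apply: homogX.
Qed.

Lemma entry_linear m k : linear ((fun w => w 0 k) : 'rV[R]_m -> R^o).
Proof. by move=> c u v; rewrite !mxE. Qed.

(** The coefficients on generators have degree 2, 1 or 2 for the first, middle and last map, which
    is the jump of the shifts. *)
Lemma differential_graded i : graded_map (d i).
Proof.
move=> e u; have [hn|hn] := ltnP n (i + 3).
  rewrite (resolution_trivial u 0 hn) linear0 => _.
  by case: i u hn => [|i] u hn; [lia | move=> j; rewrite mxE shifted_homog0].
case: i u hn => [|i] u hn /= ue.
  have hn0 : (0 + 4 <= n)%N by [].
  have := @shifted_homog_map _ _ _ _ _ (resolution_middle hn0) d0 id 2 0 e u (fun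
    _ _ _ => erefl) isT.
  rewrite {2}/shifted_homog leq0n !subn0; apply=> [v /mapP[T TT ->]|j].
    rewrite firstP //; have [x [y [s [z [w [t [-> th _]]]]]]] := Tab_near_hookP
      hn0 TT.
    case: t th => // _; rewrite specht_poly_near_hook.
    by apply: (@dhomogM _ _ _ 1 _ 1); rewrite rpredB ?homogX.
  by have := ue j; rewrite /resolution_shift ifT //; lia.
move=> k; have [hn5|hn5] := leqP (i + 5) n.
  have hn2 : (i.+1 + 4 <= n)%N by lia.
  apply: (@shifted_homog_map _ _ _ _ _ (resolution_middle hn2) (dS i)
    (fun w : tensor (S i.+1) => w 0 k) _ _ e u (@entry_linear _ k) _ _ ue).
    by rewrite /resolution_shift; do 2 case: ifP; lia.
  rewrite (_ : (_ - _)%N = 1%N); last by rewrite /resolution_shift !ifT //; lia.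
  move=> x /mapP[T TT ->].
  have [x' [y [s [z [w [t [TE th _]]]]]]] := Tab_near_hookP hn2 TT.
  rewrite (middleP hn5 (a := [:: x', z & t]) (b := [:: y;
    w]) (c := s)) ?middle_value_homog //.
  by rewrite TE /columns transpose_near_hook.
have hn2 : (i.+1 + 3 = n)%N by lia.
apply: (@shifted_homog_map _ _ _ _ _ (resolution_last hn2) (dS i)
    (fun w : tensor (S i.+1) => w 0 k) _ _ e u (@entry_linear _ k) _ _ ue).
  by rewrite /resolution_shift; do 2 case: ifP; lia.
rewrite (_ : (_ - _)%N = 2%N); last by rewrite /resolution_shift ifF ?ifT //; lia.
move=> x /mapP[T /TabPcolumn[s -> sE] ->].
have n_gt0 : (0 < n)%N by lia.
have [c ->] := polytabloid_singles K n_gt0 sE.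
have hn4 : (i + 4 = n)%N by lia.
rewrite tensZ linearZ [X in fun_of_matrix (_ *: X)](lastP hn4) mxE.
by rewrite mul_mpolyC rpredZ ?last_value_homog.
Qed.

Lemma differential_minimal i (u : resolution_module K n i.+1) : in_irrelevant (d
  i u).
Proof.
have irrtens j v r (a : I) :
    in_irrelevant (tens (S j.+1) v ('X_a * r) : resolution_module K n j.+1).
  by rewrite tensr -scalerA; apply: in_irrelevantX.
have [hn|hn] := ltnP n (i + 3).
  by rewrite (resolution_trivial u 0 hn) linear0; apply: in_irrelevant0.
have ind Xs : S i.+1 = <<Xs>>%VS ->
    (forall x, x \in Xs -> in_irrelevant (d i (tens (S i.+1) x 1))) ->
      in_irrelevant (d i u).
  move=> UX dX; move: u; apply: (tensor_ind UX) => [|u v uP vP|r x /dX xP].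
  - by rewrite linear0; apply: in_irrelevant0.
  - by rewrite linearD; apply: in_irrelevantD.
  - by rewrite linearZ; apply: in_irrelevantZ.
case: i u hn ind => [|i] u hn ind.
  have hn0 : (0 + 4 <= n)%N by [].
  apply: ind (resolution_middle hn0) _ => x /mapP[T TT ->].
  rewrite [d 0 _]firstP //; have [x' [y [s [z [w [t [-> th _]]]]]]] :=
    Tab_near_hookP hn0 TT.
  case: t th => // _; rewrite specht_poly_near_hook mulrBl.
  by apply: in_irrelevantD; [|rewrite -mulrN];
    apply: (@in_irrelevantX _ _ (gpoly K n)).
have [hn5|hn5] := leqP (i + 5) n.
  have hn2 : (i.+1 + 4 <= n)%N by lia.
  apply: ind (resolution_middle hn2) _ => x /mapP[T TT ->].
  have [x' [y [s [z [w [t [TE th _]]]]]]] := Tab_near_hookP hn2 TT.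
  rewrite [d i.+1 _](middleP hn5 (a := [:: x', z & t]) (b := [:: y;
    w]) (c := s)) //; last first.
    by rewrite TE /columns transpose_near_hook.
  apply: in_irrelevant_sum => j _; apply: in_irrelevantZ.
  by rewrite -['X_ _]mulr1; apply: irrtens.
have hn2 : (i.+1 + 3 = n)%N by lia.
apply: ind (resolution_last hn2) _ => x /mapP[T /TabPcolumn[s -> sE] ->].
have n_gt0 : (0 < n)%N by lia.
have [c ->] := polytabloid_singles K n_gt0 sE.
have hn4 : (i + 4 = n)%N by lia.
rewrite tensZ linearZ; apply: in_irrelevantZ; rewrite [d i.+1 _](lastP hn4).
apply: in_irrelevant_sum => j _; apply: in_irrelevant_sum => k _;
  apply: in_irrelevantZ.
exact: irrtens.
Qed.

Lemma Tab_uniq (lam : seq nat) : sumn lam = n -> uniq (Tab n lam).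
Proof.
move=> lam_n; rewrite map_inj_in_uniq ?permutations_uniq // => s t.
rewrite !mem_permutations => /perm_size ss /perm_size st /(congr1 flatten).
by rewrite !reshapeKr // ?ss ?st lam_n size_enum_ord.
Qed.

Lemma differential_image (p : R) :
  specht_ideal [:: n - 2; 2]%N p <-> exists v, p = d 0 v.
Proof.
have hn0 : (0 + 4 <= n)%N by [].
have lamE : [:: n - 2; 2]%N = near_hook_shape n 0 by [].
rewrite /specht_ideal lamE; split=> [[g ->]|[v ->]].
  exists (\sum_(T <- Tab n (near_hook_shape n 0)) g T *: tens (S 1) (polytabloid
    K T) 1).
  rewrite linear_sum; apply: eq_big_seq => T TT.
  by rewrite linearZ; apply: (congr1 ( *%R (g T))); apply/esym/firstP.
move: v; apply: (tensor_ind (resolution_middle hn0)) => [|u v [g gE] [g' gE']|r x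
  /mapP[T TT ->]].
- by exists (fun=> 0); rewrite linear0 big1 // => T _; rewrite mul0r.
- exists (fun T => g T + g' T); rewrite linearD gE gE' -big_split.
  by apply: eq_bigr => T _; rewrite mulrDl.
exists (fun T' => if T' == T then r else 0).
rewrite (bigD1_seq T) ?Tab_uniq ?sumn_near_hook_shape //= eqxx big1 ?addr0.
  by rewrite linearZ; apply: (congr1 ( *%R r)); apply: firstP.
by move=> T' /negPf->; rewrite mul0r.
Qed.

End Resolution.

(** The $e(T)\otimes 1$ are linearly dependent, so existence of the maps is a separate claim. The
    resolution property is then proved for every family with the prescribed values. *)
Theorem theorem3p2 (n : nat) (n_ge4 : (4 <= n)%N)
    (K : fieldType) (charK0 : [pchar K] =i pred0) :
  (exists d : forall i : nat,
     {linear resolution_module K n i.+1 -> resolution_module K n i},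
     resolution_differential d) /\
  (forall d : forall i : nat,
     {linear resolution_module K n i.+1 -> resolution_module K n i},
     resolution_differential d ->
     minimal_graded_free_resolution (specht_ideal [:: n - 2; 2]%N)
       d (idfun : {linear gpoly K n -> gpoly K n})).
Proof.
split=> [|d dP]; first exact: differential_exists.
split=> //.
- case=> [|i]; [exact: graded_free_gpoly|exact: graded_free_gtensor].
- exact: differential_graded dP.
- exact: differential_exact dP.
- exact: differential_image dP.
- move=> p; exists p; rewrite subrr; exists (fun=> 0).
  by rewrite big1 // => T _; rewrite mul0r.
- exact: differential_minimal dP.
Qed.
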